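(* Let $n\geq 1$, let ${}_{\mathcal{L}}\mathbf{SBIA}_n$ be the free left-handed skew Boolean intersection algebra on $n$ generators, $\mathbf{GBA}_n$ the free generalized Boolean algebra on $n$ generators, and $B_m$ the $m$th Bell number. (1) ${}_{\mathcal{L}}\mathbf{SBIA}_n/\mathcal{D}$ (called the partition analogue of $\mathbf{GBA}_n$) is isomorphic to $\mathbf{2}^{B_{n+1}-1}$ and thus is not isomorphic to a free generalized Boolean algebra. (2) The maximal commutative quotient of ${}_{\mathcal{L}}\mathbf{SBIA}_n$ is isomorphic to $\mathbf{2}^{2^n-1}$, which is isomorphic to $\mathbf{GBA}_n$.
   Context: A skew Boolean algebra (SBA) is an algebra $(S;\wedge,\vee,\setminus,0)$ of type $(2,2,2,0)$ satisfying: $\wedge$ and $\vee$ are associative; $x\vee(x\wedge y)=x=(y\wedge x)\vee x$ and $x\wedge(x\vee y)=x=(y\vee x)\wedge x$; $x\wedge(y\vee z)=(x\wedge y)\vee(x\wedge z)$ and $(y\vee z)\wedge x=(y\wedge x)\vee(z\wedge x)$; $x\vee 0=0\vee x=x$ and $x\wedge 0=0\wedge x=0$; $(x\setminus y)\wedge y=y\wedge(x\setminus y)=0$ and $(x\setminus y)\vee(x\wedge y\wedge x)=x=(x\wedge y\wedge x)\vee(x\setminus y)$; $x\wedge y\wedge z\wedge t=x\wedge z\wedge y\wedge t$. It is left-handed if also $x\wedge y\wedge x=x\wedge y$ and $x\vee y\vee x=y\vee x$. The natural partial order is: $x\leq y$ iff $x\wedge y=y\wedge x=x$. An SBA has intersections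 if any two elements $x,y$ have a greatest lower bound $x\sqcap y$ with respect to $\leq$; a (left-handed) skew Boolean intersection algebra (SBIA) is an algebra $(S;\wedge,\vee,\setminus,\sqcap,0)$ where $(S;\wedge,\vee,\setminus,0)$ is a (left-handed) SBA with intersections and $\sqcap$ is this meet operation. Left-handed SBIAs form a variety in the signature $(\wedge,\vee,\setminus,\sqcap,0)$; ${}_{\mathcal{L}}\mathbf{SBIA}_n$ is the free algebra on $n$ generators in this variety. Generalized Boolean algebras (GBAs) are the commutative SBAs; an SBIA is commutative if $\wedge$ and $\vee$ are commutative (then $\sqcap=\wedge$). The relation $\mathcal{D}$ is given by $x\mathrel{\mathcal{D}}y$ iff $x\wedge y\wedge x=x$ and $y\wedge x\wedge y=y$; it is a congruence on the reduct $(S;\wedge,\vee,\setminus,0)$ (not in general respecting $\sqcap$), and $S/\mathcal{D}$ denotes the quotient of this reduct, a GBA. The maximal commutative quotient of an SBIA $S$ is the quotient of $S$ by the smallest SBIA congruence (respecting all of $\wedge,\vee,\setminus,\sqcap$) whose quotient is commutative. $\mathbf{2}$ is the two-element Boolean algebra $\{0,1\}$, and $\mathbf{2}^k$ its $k$th direct power. $B_m$ is the number of partitions of an $m$-element set into non-empty blocks.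
   Formalization: The clause ''is not isomorphic to a free generalized Boolean algebra'' is stated only for n ≥ 2, since for n = 1 it is false: B_2 − 1 = 1, so the quotient is 2, which is the free generalized Boolean algebra on one generator. *)

(* Defs.v *)
(* MathComp, with the classical axioms of mathcomp.classical.boolp (used to
   form quotients of arbitrary types). *)
From HB Require Import structures.
From mathcomp Require Import all_boot boolp.

Set Implicit Arguments.
Unset Strict Implicit.
Unset Printing Implicit Defensive.

Reserved Notation "x ∧ y" (at level 40, left associativity).
Reserved Notation "x ∨ y" (at level 50, left associativity).
Reserved Notation "x ∖ y" (at level 50, left associativity).
Reserved Notation "x ⊓ y" (at level 40, left associativity).
Reserved Notation "x ≤ y" (at level 70, no associativity).

Declare Scope sba_scope.
Delimit Scope sba_scope with sba.
Local Open Scope sba_scope.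
Local Open Scope quotient_scope.

(** * Algebras *)

HB.mixin Record isSBA (S : Type) := {
  smeet : S -> S -> S;
  sjoin : S -> S -> S;
  sdiff : S -> S -> S;
  szero : S;
  smeetA : forall x y z, smeet x (smeet y z) = smeet (smeet x y) z;
  sjoinA : forall x y z, sjoin x (sjoin y z) = sjoin (sjoin x y) z;
  sjoinKr : forall x y, sjoin x (smeet x y) = x;
  sjoinKl : forall x y, sjoin (smeet y x) x = x;
  smeetKr : forall x y, smeet x (sjoin x y) = x;
  smeetKl : forall x y, smeet (sjoin y x) x = x;
  smeetUr : forall x y z, smeet x (sjoin y z) = sjoin (smeet x y) (smeet x z);
  smeetUl : forall x y z, smeet (sjoin y z) x = sjoin (smeet y x) (smeet z x);
  sjoinx0 : forall x, sjoin x szero = x;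
  sjoin0x : forall x, sjoin szero x = x;
  smeetx0 : forall x, smeet x szero = szero;
  smeet0x : forall x, smeet szero x = szero;
  sdiffKl : forall x y, smeet (sdiff x y) y = szero;
  sdiffKr : forall x y, smeet y (sdiff x y) = szero;
  sdiffUl : forall x y, sjoin (sdiff x y) (smeet (smeet x y) x) = x;
  sdiffUr : forall x y, sjoin (smeet (smeet x y) x) (sdiff x y) = x;
  smeetACA : forall x y z t,
    smeet (smeet (smeet x y) z) t = smeet (smeet (smeet x z) y) t
}.

#[short(type="sbaType")]
HB.structure Definition SBA := {S of isSBA S}.

Notation "x ∧ y" := (smeet x y) : sba_scope.
Notation "x ∨ y" := (sjoin x y) : sba_scope.
Notation "x ∖ y" := (sdiff x y) : sba_scope.

Definition sle (S : sbaType) (x y : S) : Prop := x ∧ y = x /\ y ∧ x = x.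
Notation "x ≤ y" := (sle x y) : sba_scope.

Definition is_glb (S : sbaType) (x y m : S) : Prop :=
  [/\ m ≤ x, m ≤ y & forall z, z ≤ x -> z ≤ y -> z ≤ m].

HB.mixin Record hasIntersections (S : Type) of SBA S := {
  scap : S -> S -> S;
  scap_glb : forall x y : S, is_glb x y (scap x y)
}.

#[short(type="sbiaType")]
HB.structure Definition SBIA := {S of SBA S & hasIntersections S}.

Notation "x ⊓ y" := (scap x y) : sba_scope.

HB.mixin Record isLeftHanded (S : Type) of SBA S := {
  smeet_lh : forall x y : S, x ∧ y ∧ x = x ∧ y;
  sjoin_lh : forall x y : S, x ∨ y ∨ x = y ∨ x
}.

#[short(type="lsbiaType")]
HB.structure Definition LSBIA := {S of SBIA S & isLeftHanded S}.

HB.mixin Record isCommutative (S : Type) of SBA S := {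
  smeetC : forall x y : S, x ∧ y = y ∧ x;
  sjoinC : forall x y : S, x ∨ y = y ∨ x
}.

#[short(type="gbaType")]
HB.structure Definition GBA := {S of SBA S & isCommutative S}.

Definition sba_commutative (S : sbaType) : Prop :=
  commutative (@smeet S) /\ commutative (@sjoin S).

(** * Morphisms *)

Definition sba_hom (S T : sbaType) (f : S -> T) : Prop :=
  [/\ forall x y, f (x ∧ y) = f x ∧ f y,
      forall x y, f (x ∨ y) = f x ∨ f y,
      forall x y, f (x ∖ y) = f x ∖ f y
    & f (szero : S) = szero].

Definition sbia_hom (S T : sbiaType) (f : S -> T) : Prop :=
  sba_hom f /\ forall x y, f (x ⊓ y) = f x ⊓ f y.

Definition sba_iso (S T : sbaType) : Prop :=
  exists2 f : S -> T, bijective f & sba_hom f.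

Definition sbia_iso (S T : sbiaType) : Prop :=
  exists2 f : S -> T, bijective f & sbia_hom f.

(** * Free algebras *)

Definition is_free_lsbia (X : Type) (F : lsbiaType) (i : X -> F) : Prop :=
  forall (T : lsbiaType) (f : X -> T), exists h : F -> T,
    [/\ sbia_hom h, forall x, h (i x) = f x
      & forall h' : F -> T, sbia_hom h' -> (forall x, h' (i x) = f x) ->
          forall a, h' a = h a].

Definition is_free_gba (X : Type) (G : gbaType) (i : X -> G) : Prop :=
  forall (T : gbaType) (f : X -> T), exists h : G -> T,
    [/\ sba_hom h, forall x, h (i x) = f x
      & forall h' : G -> T, sba_hom h' -> (forall x, h' (i x) = f x) ->
          forall a, h' a = h a].

(** * Elementary facts *)

Section SBATheory.
Variable S : sbaType.
Implicit Types x y z a b : S.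

Lemma smeetxx x : x ∧ x = x.
Proof. by rewrite -{2}(sjoinKr x x) smeetKr. Qed.

Lemma sle_refl x : x ≤ x.
Proof. by rewrite /sle smeetxx. Qed.

Lemma sle_anti x y : x ≤ y -> y ≤ x -> x = y.
Proof. by move=> [h _] [_ h']; rewrite -h h'. Qed.

Lemma sle_trans y x z : x ≤ y -> y ≤ z -> x ≤ z.
Proof.
move=> [h1 h2] [h3 h4]; split.
  by rewrite -{1}h1 -smeetA h3 h1.
by rewrite -{1}h2 smeetA h4 h2.
Qed.

Lemma sle_diff x y : x ∖ y ≤ x.
Proof.
set p := x ∖ y.
have e1 : x ∧ y ∧ x ∧ p = szero.
  by rewrite smeetACA -smeetA sdiffKr smeetx0.
have e2 : p ∧ (x ∧ y ∧ x) = szero.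
  by rewrite !smeetA smeetACA sdiffKl !smeet0x.
have ex : x = p ∨ x ∧ y ∧ x by rewrite sdiffUl.
split; first by rewrite {1}ex smeetUr smeetxx e2 sjoinx0.
by rewrite {1}ex smeetUl smeetxx e1 sjoinx0.
Qed.

Definition Drel x y : Prop := x ∧ y ∧ x = x /\ y ∧ x ∧ y = y.

Lemma Drel_refl x : Drel x x.
Proof. by rewrite /Drel !smeetxx. Qed.

Lemma Drel_sym x y : Drel x y -> Drel y x.
Proof. by case. Qed.

Lemma Drel_mid x y a b : Drel x y -> a ∧ x ∧ b = a ∧ y ∧ b.
Proof.
have E u v : u ∧ v ∧ u = u -> a ∧ u ∧ b = a ∧ u ∧ v ∧ b.
  move=> h; rewrite -{1}h !smeetA smeetACA -(smeetA a u u) smeetxx.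
  by rewrite -!smeetA.
by move=> [/E-> /E->]; rewrite smeetACA.
Qed.

Lemma Drel_trans y x z : Drel x y -> Drel y z -> Drel x z.
Proof.
move=> h1 h2; split.
  by rewrite -(Drel_mid x x h2) -(Drel_mid x x h1) !smeetxx.
by rewrite (Drel_mid z z h1) (Drel_mid z z h2) !smeetxx.
Qed.

Lemma Drel_meet x x' y y' : Drel x x' -> Drel y y' -> Drel (x ∧ y) (x' ∧ y').
Proof.
have half u u' v v' : Drel u u' -> Drel v v' ->
    u ∧ v ∧ (u' ∧ v') ∧ (u ∧ v) = u ∧ v.
  move=> hu hv.
  set w := u ∧ v; rewrite (smeetA w) -(Drel_mid _ _ hv) -smeetA.
  by rewrite -(Drel_mid _ _ hu) !smeetA -(smeetA w u) -/w !smeetxx -smeetA -/w smeetxx.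
by move=> h1 h2; split; apply: half => //; apply: Drel_sym.
Qed.

Lemma Drel_join x x' y y' : Drel x x' -> Drel y y' -> Drel (x ∨ y) (x' ∨ y').
Proof.
have half u u' v v' : Drel u u' -> Drel v v' ->
    (u ∨ v) ∧ (u' ∨ v') ∧ (u ∨ v) = u ∨ v.
  move=> hu hv; set w := u ∨ v.
  rewrite smeetUr smeetUl -(Drel_mid _ _ hu) -(Drel_mid _ _ hv).
  by rewrite -smeetUl -smeetUr !smeetxx.
by move=> h1 h2; split; apply: half => //; apply: Drel_sym.
Qed.

Lemma Drel_diff x x' y y' : Drel x x' -> Drel y y' -> Drel (x ∖ y) (x' ∖ y').
Proof.
have half u u' v v' : Drel u u' -> Drel v v' ->
    (u ∖ v) ∧ (u' ∖ v') ∧ (u ∖ v) = u ∖ v.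
  move=> hu hv; set p := u ∖ v.
  have pup : p ∧ u' ∧ p = p.
    rewrite -(Drel_mid _ _ hu).
    by have [e _] := sle_diff u v; rewrite -/p in e; rewrite e smeetxx.
  have pvp a : p ∧ v' ∧ a ∧ p = szero.
    rewrite -(smeetA _ a) -(Drel_mid p (a ∧ p) hv).
    by rewrite /p sdiffKl smeet0x.
  have pz : p ∧ (u' ∧ v' ∧ u') ∧ p = szero.
    have -> : p ∧ (u' ∧ v' ∧ u') ∧ p = p ∧ v' ∧ (u' ∧ u') ∧ p.
      by rewrite !smeetA (smeetACA p u' v').
    exact: pvp.
  by rewrite -[RHS]pup -[in RHS](sdiffUl u' v') smeetUr smeetUl pz sjoinx0.
by move=> h1 h2; split; apply: half => //; apply: Drel_sym.
Qed.

End SBATheory.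

(* Equations characterizing intersections; they show that SBIAs form a
   variety, so that quotients and free algebras are again SBIAs. *)
Section EquationalIntersections.
Variables (S : sbaType) (cap : S -> S -> S).
Hypothesis capA : forall x y z, cap x (cap y z) = cap (cap x y) z.
Hypothesis capC : forall x y, cap x y = cap y x.
Hypothesis cap_leL : forall x y, x ∧ cap x y = cap x y.
Hypothesis cap_leR : forall x y, cap x y ∧ x = cap x y.
Hypothesis cap_band : forall x y, cap (x ∧ y ∧ x) x = x ∧ y ∧ x.

Lemma eq_cap_glb (x y : S) : is_glb x y (cap x y).
Proof.
have capl z t : z ≤ t -> cap z t = z.
  by move=> [h1 h2]; have := cap_band t z; rewrite h2 h1.
have lel u v : cap u v ≤ u by split; rewrite ?cap_leR ?cap_leL.
split=> [//||z hx hy]; first by rewrite capC.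
suff <- : cap (cap x y) z = z by [].
by rewrite capC capA (capl _ _ hx) (capl _ _ hy).
Qed.
End EquationalIntersections.

Lemma is_glb_uniq (S : sbaType) (x y m m' : S) :
  is_glb x y m -> is_glb x y m' -> m = m'.
Proof. by move=> [a b c] [d e f]; apply: sle_anti; [apply: f|apply: c]. Qed.

Section IntersectionTheory.
Variables (S : sbaType) (cap : S -> S -> S).
Hypothesis glb : forall x y, is_glb x y (cap x y).
Implicit Types x y z : S.

Lemma glb_le_l x y : cap x y ≤ x. Proof. by case: (glb x y). Qed.
Lemma glb_le_r x y : cap x y ≤ y. Proof. by case: (glb x y). Qed.
Lemma glb_max x y z : z ≤ x -> z ≤ y -> z ≤ cap x y.
Proof. by case: (glb x y) => _ _; apply. Qed.

Lemma glbC x y : cap x y = cap y x.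
Proof. by apply: sle_anti; apply: glb_max; auto using glb_le_l, glb_le_r. Qed.

Lemma glbA x y z : cap x (cap y z) = cap (cap x y) z.
Proof.
by apply: sle_anti; repeat apply: glb_max;
  eauto using sle_trans, glb_le_l, glb_le_r.
Qed.

Lemma glb_leL x y : x ∧ cap x y = cap x y.
Proof. by case: (glb_le_l x y). Qed.

Lemma glb_leR x y : cap x y ∧ x = cap x y.
Proof. by case: (glb_le_l x y). Qed.

Lemma glb_band x y : cap (x ∧ y ∧ x) x = x ∧ y ∧ x.
Proof.
apply: sle_anti; first exact: glb_le_l.
apply: glb_max; first exact: sle_refl.
by split; rewrite ?smeetA ?smeetxx // -smeetA smeetxx.
Qed.

End IntersectionTheory.

Section SBIATheory.
Variable S : sbiaType.

Definition scapC := glbC (@scap_glb S).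
Definition scapA := glbA (@scap_glb S).
Definition scap_leL := glb_leL (@scap_glb S).
Definition scap_leR := glb_leR (@scap_glb S).
Definition scap_band := glb_band (@scap_glb S).

End SBIATheory.

(** * Quotients *)

Section EquivQuotient.
Variables (T : Type) (R : T -> T -> Prop).
Hypothesis Rr : forall x, R x x.
Hypothesis Rs : forall x y, R x y -> R y x.
Hypothesis Rt : forall y x z, R x y -> R y z -> R x z.

Definition qrel : rel {classic T} := fun x y => `[< R x y >].

Lemma qrel_refl : reflexive qrel. Proof. by move=> x; apply/asboolP. Qed.
Lemma qrel_sym : symmetric qrel.
Proof. by move=> x y; apply/asboolP/asboolP; apply: Rs. Qed.
Lemma qrel_trans : transitive qrel.
Proof. by move=> y x z /asboolP h /asboolP k; apply/asboolP; apply: Rt h k. Qed.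

Canonical qrel_equiv := EquivRel qrel qrel_refl qrel_sym qrel_trans.

Definition equot : Type := {eq_quot qrel_equiv}.
Definition ecls (x : T) : equot := \pi_{eq_quot qrel_equiv} (x : {classic T}).
Definition erep (q : equot) : T := repr (q : {eq_quot qrel_equiv}).

Lemma erepK q : ecls (erep q) = q. Proof. exact: reprK. Qed.

Lemma eclsP x y : ecls x = ecls y <-> R x y.
Proof. by split=> [/eqmodP/asboolP|h]; last by apply/eqmodP/asboolP. Qed.

Lemma erep_cls x : R (erep (ecls x)) x.
Proof. by apply/eclsP; rewrite erepK. Qed.
End EquivQuotient.

Record sba_congruence (S : sbaType) := SBACongruence {
  congr_rel :> S -> S -> Prop;
  congr_refl : forall x, congr_rel x x;
  congr_sym : forall x y, congr_rel x y -> congr_rel y x;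
  congr_trans : forall y x z,
    congr_rel x y -> congr_rel y z -> congr_rel x z;
  congr_meet : forall x x' y y',
    congr_rel x x' -> congr_rel y y' -> congr_rel (x ∧ y) (x' ∧ y');
  congr_join : forall x x' y y',
    congr_rel x x' -> congr_rel y y' -> congr_rel (x ∨ y) (x' ∨ y');
  congr_diff : forall x x' y y',
    congr_rel x x' -> congr_rel y y' -> congr_rel (x ∖ y) (x' ∖ y')
}.

Record sbia_congruence (S : sbiaType) := SBIACongruence {
  sba_congr_of :> sba_congruence S;
  congr_cap : forall x x' y y',
    sba_congr_of x x' -> sba_congr_of y y' -> sba_congr_of (x ⊓ y) (x' ⊓ y')
}.

Section SBAQuotient.
Variables (S : sbaType) (c : sba_congruence S).

Definition quot : Type :=
  equot (congr_refl c) (@congr_sym _ c) (@congr_trans _ c).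
Definition cls : S -> quot := @ecls _ _ _ _ _.
Definition rep : quot -> S := @erep _ _ _ _ _.

Lemma repK q : cls (rep q) = q. Proof. exact: erepK. Qed.
Lemma clsP x y : cls x = cls y <-> c x y. Proof. exact: eclsP. Qed.
Lemma rep_cls x : c (rep (cls x)) x. Proof. exact: erep_cls. Qed.

Definition qmeet (p q : quot) : quot := cls (rep p ∧ rep q).
Definition qjoin (p q : quot) : quot := cls (rep p ∨ rep q).
Definition qdiff (p q : quot) : quot := cls (rep p ∖ rep q).

Lemma qmeetE x y : qmeet (cls x) (cls y) = cls (x ∧ y).
Proof. by apply/clsP; apply: congr_meet; apply: rep_cls. Qed.
Lemma qjoinE x y : qjoin (cls x) (cls y) = cls (x ∨ y).
Proof. by apply/clsP; apply: congr_join; apply: rep_cls. Qed.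
Lemma qdiffE x y : qdiff (cls x) (cls y) = cls (x ∖ y).
Proof. by apply/clsP; apply: congr_diff; apply: rep_cls. Qed.

Let qE := (qmeetE, qjoinE, qdiffE).

Lemma quot_ind (P : quot -> Prop) : (forall x, P (cls x)) -> forall q, P q.
Proof. by move=> h q; rewrite -(repK q). Qed.

Local Ltac by_cls := repeat (elim/quot_ind => ?); rewrite ?qE; congr (cls _).

Fact qmeetA x y z : qmeet x (qmeet y z) = qmeet (qmeet x y) z.
Proof. move: x y z; by_cls; exact: smeetA. Qed.
Fact qjoinA x y z : qjoin x (qjoin y z) = qjoin (qjoin x y) z.
Proof. move: x y z; by_cls; exact: sjoinA. Qed.
Fact qjoinKr x y : qjoin x (qmeet x y) = x.
Proof. move: x y; by_cls; exact: sjoinKr. Qed.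
Fact qjoinKl x y : qjoin (qmeet y x) x = x.
Proof. move: x y; by_cls; exact: sjoinKl. Qed.
Fact qmeetKr x y : qmeet x (qjoin x y) = x.
Proof. move: x y; by_cls; exact: smeetKr. Qed.
Fact qmeetKl x y : qmeet (qjoin y x) x = x.
Proof. move: x y; by_cls; exact: smeetKl. Qed.
Fact qmeetUr x y z : qmeet x (qjoin y z) = qjoin (qmeet x y) (qmeet x z).
Proof. move: x y z; by_cls; exact: smeetUr. Qed.
Fact qmeetUl x y z : qmeet (qjoin y z) x = qjoin (qmeet y x) (qmeet z x).
Proof. move: x y z; by_cls; exact: smeetUl. Qed.
Fact qjoinx0 x : qjoin x (cls szero) = x.
Proof. move: x; by_cls; exact: sjoinx0. Qed.
Fact qjoin0x x : qjoin (cls szero) x = x.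
Proof. move: x; by_cls; exact: sjoin0x. Qed.
Fact qmeetx0 x : qmeet x (cls szero) = cls szero.
Proof. move: x; by_cls; exact: smeetx0. Qed.
Fact qmeet0x x : qmeet (cls szero) x = cls szero.
Proof. move: x; by_cls; exact: smeet0x. Qed.
Fact qdiffKl x y : qmeet (qdiff x y) y = cls szero.
Proof. move: x y; by_cls; exact: sdiffKl. Qed.
Fact qdiffKr x y : qmeet y (qdiff x y) = cls szero.
Proof. move: x y; by_cls; exact: sdiffKr. Qed.
Fact qdiffUl x y : qjoin (qdiff x y) (qmeet (qmeet x y) x) = x.
Proof. move: x y; by_cls; exact: sdiffUl. Qed.
Fact qdiffUr x y : qjoin (qmeet (qmeet x y) x) (qdiff x y) = x.
Proof. move: x y; by_cls; exact: sdiffUr. Qed.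
Fact qmeetACA x y z t :
  qmeet (qmeet (qmeet x y) z) t = qmeet (qmeet (qmeet x z) y) t.
Proof. move: x y z t; by_cls; exact: smeetACA. Qed.

HB.instance Definition _ := isSBA.Build quot
  qmeetA qjoinA qjoinKr qjoinKl qmeetKr qmeetKl qmeetUr qmeetUl
  qjoinx0 qjoin0x qmeetx0 qmeet0x qdiffKl qdiffKr qdiffUl qdiffUr qmeetACA.

Lemma cls_hom : sba_hom cls.
Proof. by split=> // x y; rewrite -?(qmeetE, qjoinE, qdiffE). Qed.

End SBAQuotient.

Section SBIAQuotient.
Variables (S : sbiaType) (c : sbia_congruence S).

Local Notation Q := (quot c).

Definition qcap (p q : Q) : Q := cls c (rep p ⊓ rep q).

Lemma qcapE x y : qcap (cls c x) (cls c y) = cls c (x ⊓ y).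
Proof. by apply/clsP; apply: congr_cap; apply: rep_cls. Qed.

Fact qcapA x y z : qcap x (qcap y z) = qcap (qcap x y) z.
Proof.
move: x y z; do 3!elim/quot_ind => ?.
by rewrite !qcapE scapA.
Qed.
Fact qcapC x y : qcap x y = qcap y x.
Proof.
by move: x y; elim/quot_ind => x; elim/quot_ind => y; rewrite !qcapE scapC.
Qed.
Fact qcap_leL (x y : Q) : x ∧ qcap x y = qcap x y.
Proof.
move: x y; elim/quot_ind => x; elim/quot_ind => y.
by rewrite qcapE [LHS]qmeetE scap_leL.
Qed.
Fact qcap_leR (x y : Q) : qcap x y ∧ x = qcap x y.
Proof.
move: x y; elim/quot_ind => x; elim/quot_ind => y.
by rewrite qcapE [LHS]qmeetE scap_leR.
Qed.
Fact qcap_band (x y : Q) : qcap (x ∧ y ∧ x) x = x ∧ y ∧ x.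
Proof.
move: x y; elim/quot_ind => x; elim/quot_ind => y.
have -> : (cls c x : Q) ∧ cls c y ∧ cls c x = cls c (x ∧ y ∧ x).
  by rewrite -!qmeetE.
by rewrite qcapE scap_band.
Qed.

Fact qcap_glb (x y : Q) : is_glb x y (qcap x y).
Proof. exact: eq_cap_glb qcapA qcapC qcap_leL qcap_leR qcap_band x y. Qed.

HB.instance Definition _ := hasIntersections.Build Q qcap_glb.

Lemma icls_hom : sbia_hom (cls c : S -> Q).
Proof. by split; [exact: cls_hom|move=> x y; rewrite -qcapE]. Qed.

End SBIAQuotient.

(* On an SBIA, [quot (Dcongr S)] is a quotient of the SBA reduct only. *)
Definition Dcongr (S : sbaType) : sba_congruence S :=
  @SBACongruence S (@Drel S) (@Drel_refl S) (@Drel_sym S) (@Drel_trans S)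
    (@Drel_meet S) (@Drel_join S) (@Drel_diff S).

Section MaxCommQuotient.
Variable S : sbiaType.

(* The intersection of all SBIA congruences with commutative quotient; it is
   the smallest one by [min_comm_congr_comm] and [min_comm_congr_min]. *)
Definition min_comm_rel (x y : S) : Prop :=
  forall c : sbia_congruence S, sba_commutative (quot c) -> c x y.

Fact mcr_refl x : min_comm_rel x x.
Proof. by move=> c _; apply: congr_refl. Qed.
Fact mcr_sym x y : min_comm_rel x y -> min_comm_rel y x.
Proof. by move=> h c hc; apply/congr_sym/h. Qed.
Fact mcr_trans y x z :
  min_comm_rel x y -> min_comm_rel y z -> min_comm_rel x z.
Proof. by move=> h k c hc; apply: congr_trans (h c hc) (k c hc). Qed.
Fact mcr_meet x x' y y' : min_comm_rel x x' -> min_comm_rel y y' ->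
  min_comm_rel (x ∧ y) (x' ∧ y').
Proof. by move=> h k c hc; apply: congr_meet (h c hc) (k c hc). Qed.
Fact mcr_join x x' y y' : min_comm_rel x x' -> min_comm_rel y y' ->
  min_comm_rel (x ∨ y) (x' ∨ y').
Proof. by move=> h k c hc; apply: congr_join (h c hc) (k c hc). Qed.
Fact mcr_diff x x' y y' : min_comm_rel x x' -> min_comm_rel y y' ->
  min_comm_rel (x ∖ y) (x' ∖ y').
Proof. by move=> h k c hc; apply: congr_diff (h c hc) (k c hc). Qed.
Fact mcr_cap x x' y y' : min_comm_rel x x' -> min_comm_rel y y' ->
  min_comm_rel (x ⊓ y) (x' ⊓ y').
Proof. by move=> h k c hc; apply: congr_cap (h c hc) (k c hc). Qed.

Definition min_comm_congr : sbia_congruence S :=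
  @SBIACongruence S
    (SBACongruence mcr_refl mcr_sym mcr_trans mcr_meet mcr_join mcr_diff)
    mcr_cap.

Lemma min_comm_congr_comm : sba_commutative (quot min_comm_congr).
Proof.
split=> p q; rewrite -(repK p) -(repK q).
  rewrite ![LHS]qmeetE ![RHS]qmeetE; apply/clsP => c [hc _]; apply/clsP.
  by rewrite -!qmeetE; apply: hc.
rewrite ![LHS]qjoinE ![RHS]qjoinE; apply/clsP => c [_ hc]; apply/clsP.
by rewrite -!qjoinE; apply: hc.
Qed.

Lemma min_comm_congr_min (c : sbia_congruence S) :
  sba_commutative (quot c) -> forall x y, min_comm_congr x y -> c x y.
Proof. by move=> hc x y; apply. Qed.

End MaxCommQuotient.

(** * Powers of the two-element Boolean algebra *)

Definition pow2 (k : nat) : Type := {ffun 'I_k -> bool}.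

Section Pow2.
Variable k : nat.
Implicit Types x y z t : pow2 k.

Definition pmeet x y : pow2 k := [ffun i => x i && y i].
Definition pjoin x y : pow2 k := [ffun i => x i || y i].
Definition pdiff x y : pow2 k := [ffun i => x i && ~~ y i].
Definition pzero : pow2 k := [ffun => false].

Local Ltac by_bits := let i := fresh "i" in apply/ffunP => i; rewrite !ffunE;
  repeat match goal with x : pow2 k |- _ => case: (x i); clear x end; by [].

Fact pmeetA x y z : pmeet x (pmeet y z) = pmeet (pmeet x y) z.
Proof. by_bits. Qed.
Fact pjoinA x y z : pjoin x (pjoin y z) = pjoin (pjoin x y) z.
Proof. by_bits. Qed.
Fact pjoinKr x y : pjoin x (pmeet x y) = x. Proof. by_bits. Qed.
Fact pjoinKl x y : pjoin (pmeet y x) x = x. Proof. by_bits. Qed.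
Fact pmeetKr x y : pmeet x (pjoin x y) = x. Proof. by_bits. Qed.
Fact pmeetKl x y : pmeet (pjoin y x) x = x. Proof. by_bits. Qed.
Fact pmeetUr x y z : pmeet x (pjoin y z) = pjoin (pmeet x y) (pmeet x z).
Proof. by_bits. Qed.
Fact pmeetUl x y z : pmeet (pjoin y z) x = pjoin (pmeet y x) (pmeet z x).
Proof. by_bits. Qed.
Fact pjoinx0 x : pjoin x pzero = x. Proof. by_bits. Qed.
Fact pjoin0x x : pjoin pzero x = x. Proof. by_bits. Qed.
Fact pmeetx0 x : pmeet x pzero = pzero. Proof. by_bits. Qed.
Fact pmeet0x x : pmeet pzero x = pzero. Proof. by_bits. Qed.
Fact pdiffKl x y : pmeet (pdiff x y) y = pzero. Proof. by_bits. Qed.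
Fact pdiffKr x y : pmeet y (pdiff x y) = pzero. Proof. by_bits. Qed.
Fact pdiffUl x y : pjoin (pdiff x y) (pmeet (pmeet x y) x) = x.
Proof. by_bits. Qed.
Fact pdiffUr x y : pjoin (pmeet (pmeet x y) x) (pdiff x y) = x.
Proof. by_bits. Qed.
Fact pmeetACA x y z t :
  pmeet (pmeet (pmeet x y) z) t = pmeet (pmeet (pmeet x z) y) t.
Proof. by_bits. Qed.

HB.instance Definition _ := isSBA.Build (pow2 k)
  pmeetA pjoinA pjoinKr pjoinKl pmeetKr pmeetKl pmeetUr pmeetUl
  pjoinx0 pjoin0x pmeetx0 pmeet0x pdiffKl pdiffKr pdiffUl pdiffUr pmeetACA.

Fact pmeetC x y : pmeet x y = pmeet y x. Proof. by_bits. Qed.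
Fact pjoinC x y : pjoin x y = pjoin y x. Proof. by_bits. Qed.

HB.instance Definition _ := isCommutative.Build (pow2 k) pmeetC pjoinC.

Fact pmeet_glb x y : is_glb x y (pmeet x y).
Proof.
have le u v : u ≤ v <-> pmeet u v = u.
  by split=> [[]|h] //; split=> //; rewrite /smeet /= pmeetC.
split; [apply/le; by_bits|apply/le; by_bits|].
by move=> z /le hx /le hy; apply/le; rewrite pmeetA hx.
Qed.

HB.instance Definition _ := hasIntersections.Build (pow2 k) pmeet_glb.

End Pow2.

Definition Bell (m : nat) : nat :=
  #|[set P : {set {set 'I_m}} | partition P [set: 'I_m]]|.

(** * Existence of free algebras *)

Inductive term (X : Type) : Type :=
| Var of X
| Zero
| Meet of term X & term X
| Join of term X & term X
| Diff of term X & term X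
| Cap of term X & term X.

Fixpoint eval (X : Type) (T : sbaType) (cap : T -> T -> T) (f : X -> T)
    (t : term X) : T :=
  match t with
  | Var x => f x
  | Zero => szero
  | Meet a b => eval cap f a ∧ eval cap f b
  | Join a b => eval cap f a ∨ eval cap f b
  | Diff a b => eval cap f a ∖ eval cap f b
  | Cap a b => cap (eval cap f a) (eval cap f b)
  end.

Section FreeAlgebra.
Variable X : Type.
Variable V : forall T : sbaType, (T -> T -> T) -> Prop.
Implicit Types s t u v : term X.

(* [s] and [t] agree in every algebra of the class [V]. *)
Definition teq s t : Prop := forall (T : sbaType) (cap : T -> T -> T) (f : X -> T),
  V cap -> eval cap f s = eval cap f t.

Fact teq_refl s : teq s s. Proof. by []. Qed.
Fact teq_sym s t : teq s t -> teq t s.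
Proof. by move=> h T cap f hV; rewrite h. Qed.
Fact teq_trans t s u : teq s t -> teq t u -> teq s u.
Proof. by move=> h k T cap f hV; rewrite h ?k. Qed.

Definition free_alg : Type := equot teq_refl teq_sym teq_trans.
Definition tcls : term X -> free_alg := @ecls _ _ _ _ _.
Definition trep : free_alg -> term X := @erep _ _ _ _ _.

Lemma trepK q : tcls (trep q) = q. Proof. exact: erepK. Qed.
Lemma tclsP s t : tcls s = tcls t <-> teq s t. Proof. exact: eclsP. Qed.
Lemma trep_cls s : teq (trep (tcls s)) s. Proof. exact: erep_cls. Qed.

Definition tmeet (p q : free_alg) := tcls (Meet (trep p) (trep q)).
Definition tjoin (p q : free_alg) := tcls (Join (trep p) (trep q)).
Definition tdiff (p q : free_alg) := tcls (Diff (trep p) (trep q)).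
Definition tcap (p q : free_alg) := tcls (Cap (trep p) (trep q)).

Lemma tmeetE s t : tmeet (tcls s) (tcls t) = tcls (Meet s t).
Proof. by apply/tclsP => T cap f hV /=; rewrite !trep_cls. Qed.
Lemma tjoinE s t : tjoin (tcls s) (tcls t) = tcls (Join s t).
Proof. by apply/tclsP => T cap f hV /=; rewrite !trep_cls. Qed.
Lemma tdiffE s t : tdiff (tcls s) (tcls t) = tcls (Diff s t).
Proof. by apply/tclsP => T cap f hV /=; rewrite !trep_cls. Qed.
Lemma tcapE s t : tcap (tcls s) (tcls t) = tcls (Cap s t).
Proof. by apply/tclsP => T cap f hV /=; rewrite !trep_cls. Qed.

Lemma tcls_ind (P : free_alg -> Prop) : (forall s, P (tcls s)) -> forall q, P q.
Proof. by move=> h q; rewrite -(trepK q). Qed.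

Let tE := (tmeetE, tjoinE, tdiffE, tcapE).
Local Ltac by_tcls := repeat (elim/tcls_ind => ?); rewrite ?tE;
  apply/tclsP => ? ? ? ? /=.

Fact tmeetA x y z : tmeet x (tmeet y z) = tmeet (tmeet x y) z.
Proof. move: x y z; by_tcls; exact: smeetA. Qed.
Fact tjoinA x y z : tjoin x (tjoin y z) = tjoin (tjoin x y) z.
Proof. move: x y z; by_tcls; exact: sjoinA. Qed.
Fact tjoinKr x y : tjoin x (tmeet x y) = x.
Proof. move: x y; by_tcls; exact: sjoinKr. Qed.
Fact tjoinKl x y : tjoin (tmeet y x) x = x.
Proof. move: x y; by_tcls; exact: sjoinKl. Qed.
Fact tmeetKr x y : tmeet x (tjoin x y) = x.
Proof. move: x y; by_tcls; exact: smeetKr. Qed.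
Fact tmeetKl x y : tmeet (tjoin y x) x = x.
Proof. move: x y; by_tcls; exact: smeetKl. Qed.
Fact tmeetUr x y z : tmeet x (tjoin y z) = tjoin (tmeet x y) (tmeet x z).
Proof. move: x y z; by_tcls; exact: smeetUr. Qed.
Fact tmeetUl x y z : tmeet (tjoin y z) x = tjoin (tmeet y x) (tmeet z x).
Proof. move: x y z; by_tcls; exact: smeetUl. Qed.
Fact tjoinx0 x : tjoin x (tcls (Zero X)) = x.
Proof. move: x; by_tcls; exact: sjoinx0. Qed.
Fact tjoin0x x : tjoin (tcls (Zero X)) x = x.
Proof. move: x; by_tcls; exact: sjoin0x. Qed.
Fact tmeetx0 x : tmeet x (tcls (Zero X)) = tcls (Zero X).
Proof. move: x; by_tcls; exact: smeetx0. Qed.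
Fact tmeet0x x : tmeet (tcls (Zero X)) x = tcls (Zero X).
Proof. move: x; by_tcls; exact: smeet0x. Qed.
Fact tdiffKl x y : tmeet (tdiff x y) y = tcls (Zero X).
Proof. move: x y; by_tcls; exact: sdiffKl. Qed.
Fact tdiffKr x y : tmeet y (tdiff x y) = tcls (Zero X).
Proof. move: x y; by_tcls; exact: sdiffKr. Qed.
Fact tdiffUl x y : tjoin (tdiff x y) (tmeet (tmeet x y) x) = x.
Proof. move: x y; by_tcls; exact: sdiffUl. Qed.
Fact tdiffUr x y : tjoin (tmeet (tmeet x y) x) (tdiff x y) = x.
Proof. move: x y; by_tcls; exact: sdiffUr. Qed.
Fact tmeetACA x y z w :
  tmeet (tmeet (tmeet x y) z) w = tmeet (tmeet (tmeet x z) y) w.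
Proof. move: x y z w; by_tcls; exact: smeetACA. Qed.

HB.instance Definition _ := isSBA.Build free_alg
  tmeetA tjoinA tjoinKr tjoinKl tmeetKr tmeetKl tmeetUr tmeetUl
  tjoinx0 tjoin0x tmeetx0 tmeet0x tdiffKl tdiffKr tdiffUl tdiffUr tmeetACA.

Definition tgen (x : X) : free_alg := tcls (Var x).

Section Lift.
Variables (T : sbaType) (cap : T -> T -> T) (f : X -> T).
Hypothesis hV : V cap.

Definition tlift (q : free_alg) : T := eval cap f (trep q).

Lemma tlift_cls s : tlift (tcls s) = eval cap f s.
Proof. exact: trep_cls hV. Qed.

Lemma tlift_hom : sba_hom tlift.
Proof. by split=> *; rewrite tlift_cls. Qed.

Lemma tlift_cap p q : tlift (tcap p q) = cap (tlift p) (tlift q).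
Proof. by rewrite tlift_cls. Qed.

Lemma tlift_gen x : tlift (tgen x) = f x.
Proof. exact: tlift_cls. Qed.

Lemma tlift_uniq (h : free_alg -> T) : sba_hom h ->
  (forall p q, h (tcap p q) = cap (h p) (h q)) ->
  (forall x, h (tgen x) = f x) -> forall q, h q = tlift q.
Proof.
move=> [hm hj hd h0] hc hg; elim/tcls_ind => s; rewrite tlift_cls.
elim: s => [x||s IHs t IHt|s IHs t IHt|s IHs t IHt|s IHs t IHt] /=;
  first [exact: hg | exact: h0 | rewrite -{}IHs -{}IHt].
- by rewrite -hm -tmeetE.
- by rewrite -hj -tjoinE.
- by rewrite -hd -tdiffE.
- by rewrite -hc tcapE.
Qed.
End Lift.
End FreeAlgebra.

Definition lsbia_class (T : sbaType) (cap : T -> T -> T) : Prop :=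
  [/\ forall x y, is_glb x y (cap x y),
      forall x y : T, x ∧ y ∧ x = x ∧ y
    & forall x y : T, x ∨ y ∨ x = y ∨ x].

Definition gba_class (T : sbaType) (cap : T -> T -> T) : Prop :=
  sba_commutative T /\ cap = @smeet T.

Section FreeLSBIA.
Variable X : Type.

Local Notation free_lsbia := (free_alg X (@lsbia_class)).
Local Notation tcl := (@tcls X lsbia_class).
Definition lcap (p q : free_lsbia) : free_lsbia := tcap p q.

Let mE s t : (tcl s : free_lsbia) ∧ (tcl t : free_lsbia) = tcl (Meet s t).
Proof. exact: tmeetE. Qed.
Let jE s t : (tcl s : free_lsbia) ∨ (tcl t : free_lsbia) = tcl (Join s t).
Proof. exact: tjoinE. Qed.
Let cE s t : lcap (tcl s) (tcl t) = tcl (Cap s t).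
Proof. exact: tcapE. Qed.

Local Ltac by_eval glb lhm lhj :=
  repeat (elim/tcls_ind => ?); rewrite ?(mE, jE, cE);
  apply/tclsP => ? ? ? [glb lhm lhj] /=.

Fact lcapA x y z : lcap x (lcap y z) = lcap (lcap x y) z.
Proof. move: x y z; by_eval glb lhm lhj; exact: (glbA glb). Qed.
Fact lcapC x y : lcap x y = lcap y x.
Proof. move: x y; by_eval glb lhm lhj; exact: (glbC glb). Qed.
Fact lcap_leL (x y : free_lsbia) : x ∧ lcap x y = lcap x y.
Proof. move: x y; by_eval glb lhm lhj; exact: (glb_leL glb). Qed.
Fact lcap_leR (x y : free_lsbia) : lcap x y ∧ x = lcap x y.
Proof. move: x y; by_eval glb lhm lhj; exact: (glb_leR glb). Qed.
Fact lcap_band (x y : free_lsbia) : lcap (x ∧ y ∧ x) x = x ∧ y ∧ x.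
Proof. move: x y; by_eval glb lhm lhj; exact: (glb_band glb). Qed.
Fact lmeet_lh (x y : free_lsbia) : x ∧ y ∧ x = x ∧ y.
Proof. move: x y; by_eval glb lhm lhj; exact: lhm. Qed.
Fact ljoin_lh (x y : free_lsbia) : x ∨ y ∨ x = y ∨ x.
Proof. move: x y; by_eval glb lhm lhj; exact: lhj. Qed.

Fact lcap_glb (x y : free_lsbia) : is_glb x y (lcap x y).
Proof. exact: eq_cap_glb lcapA lcapC lcap_leL lcap_leR lcap_band x y. Qed.

HB.instance Definition _ := hasIntersections.Build free_lsbia lcap_glb.
HB.instance Definition _ := isLeftHanded.Build free_lsbia lmeet_lh ljoin_lh.

Lemma free_lsbiaP : is_free_lsbia (@tgen X lsbia_class : X -> free_lsbia).
Proof.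
move=> T f.
have hV : lsbia_class (@scap T).
  by split; [exact: scap_glb|exact: smeet_lh|exact: sjoin_lh].
exists (tlift (@scap T) f); split.
- split; [exact: tlift_hom|exact: tlift_cap].
- exact: tlift_gen.
- by move=> h [hh hc] hg; apply: tlift_uniq.
Qed.

End FreeLSBIA.

Section FreeGBA.
Variable X : Type.

Local Notation free_gba := (free_alg X (@gba_class)).

Fact gmeetC (x y : free_gba) : x ∧ y = y ∧ x.
Proof.
move: x y; elim/tcls_ind => x; elim/tcls_ind => y.
rewrite [LHS]tmeetE [RHS]tmeetE; apply/tclsP => T cap f [[h _] _]; exact: h.
Qed.
Fact gjoinC (x y : free_gba) : x ∨ y = y ∨ x.
Proof.
move: x y; elim/tcls_ind => x; elim/tcls_ind => y.
rewrite [LHS]tjoinE [RHS]tjoinE; apply/tclsP => T cap f [[_ h] _]; exact: h.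
Qed.

HB.instance Definition _ := isCommutative.Build free_gba gmeetC gjoinC.

Fact gcapE (x y : free_gba) : tcap x y = x ∧ y.
Proof.
move: x y; elim/tcls_ind => x; elim/tcls_ind => y.
by rewrite tcapE [RHS]tmeetE; apply/tclsP => T cap f [_ ->].
Qed.

Lemma free_gbaP : is_free_gba (@tgen X gba_class : X -> free_gba).
Proof.
move=> T f.
have hV : gba_class (@smeet T).
  by split=> //; split; [exact: smeetC|exact: sjoinC].
exists (tlift (@smeet T) f); split.
- exact: tlift_hom.
- exact: tlift_gen.
- move=> h hh hg; apply: tlift_uniq => // p q.
  by rewrite gcapE; case: hh.
Qed.

End FreeGBA.

(* Main.v *)
(* In a left-handed SBIA, restriction [x |-> x ∧ c] is an endomorphism. Given
   generators g_1, ..., g_n and a nonzero c, one can shrink c until it is below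
   or disjoint from every g_j and every g_j ⊓ g_k; after restriction to such a c
   the generators together with 0 are closed under the operations, which act as
   in a primitive algebra (one nonzero D-class, trivial intersections), where
   only the kernel partition of {0, g_1, ..., g_n} matters. Hence the free
   algebra embeds into the product of the primitive algebras of the partitions
   of {0, ..., n}, and modulo D it becomes 2 to the number of partitions with
   more than one block. In a commutative quotient the primitive algebras are 2
   or 0, so that only the subsets of the generators count. Finally
   2^(Bell(n+1)-1) is not free for n >= 2 because a free GBA 2^k has k + 1 a
   power of 2, whereas Bell numbers are never divisible by 8. *)
From HB Require Import structures.
Require Import Defs.
From mathcomp Require Import all_boot boolp.

Set Implicit Arguments.
Unset Strict Implicit.
Unset Printing Implicit Defensive.

Local Open Scope sba_scope.

(** * Primitive algebras *)

(** The alias puts the chosen zero [z] into the type, so that each choice carries its own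
    instances. *)
Definition prim (T : eqType) (z : T) : Type := T.

Section Primitive.
Variables (T : eqType) (z : T).
Implicit Types x y t w : prim z.

Definition prim_meet x y : prim z := if y == z :> T then z else x.
Definition prim_join x y : prim z := if y == z :> T then x else y.
Definition prim_diff x y : prim z := if y == z :> T then x else z.
Definition prim_cap x y : prim z := if x == y :> T then x else z.

Local Ltac by_prim := rewrite /prim_meet /prim_join /prim_diff /prim_cap;
  repeat case: eqP; congruence.

Fact prim_meetA x y t : prim_meet x (prim_meet y t) = prim_meet (prim_meet x y) t.
Proof. by_prim. Qed.
Fact prim_joinA x y t : prim_join x (prim_join y t) = prim_join (prim_join x y) t.
Proof. by_prim. Qed.
Fact prim_joinKr x y : prim_join x (prim_meet x y) = x. Proof. by_prim. Qed.
Fact prim_joinKl x y : prim_join (prim_meet y x) x = x. Proof. by_prim. Qed.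
Fact prim_meetKr x y : prim_meet x (prim_join x y) = x. Proof. by_prim. Qed.
Fact prim_meetKl x y : prim_meet (prim_join y x) x = x. Proof. by_prim. Qed.
Fact prim_meetUr x y t :
  prim_meet x (prim_join y t) = prim_join (prim_meet x y) (prim_meet x t).
Proof. by_prim. Qed.
Fact prim_meetUl x y t :
  prim_meet (prim_join y t) x = prim_join (prim_meet y x) (prim_meet t x).
Proof. by_prim. Qed.
Fact prim_joinx0 x : prim_join x z = x. Proof. by_prim. Qed.
Fact prim_join0x x : prim_join z x = x. Proof. by_prim. Qed.
Fact prim_meetx0 x : prim_meet x z = z. Proof. by_prim. Qed.
Fact prim_meet0x x : prim_meet z x = z. Proof. by_prim. Qed.
Fact prim_diffKl x y : prim_meet (prim_diff x y) y = z. Proof. by_prim. Qed.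
Fact prim_diffKr x y : prim_meet y (prim_diff x y) = z. Proof. by_prim. Qed.
Fact prim_diffUl x y :
  prim_join (prim_diff x y) (prim_meet (prim_meet x y) x) = x.
Proof. by_prim. Qed.
Fact prim_diffUr x y :
  prim_join (prim_meet (prim_meet x y) x) (prim_diff x y) = x.
Proof. by_prim. Qed.
Fact prim_meetACA x y t w : prim_meet (prim_meet (prim_meet x y) t) w =
  prim_meet (prim_meet (prim_meet x t) y) w.
Proof. by_prim. Qed.

HB.instance Definition _ := isSBA.Build (prim z)
  prim_meetA prim_joinA prim_joinKr prim_joinKl prim_meetKr prim_meetKl
  prim_meetUr prim_meetUl prim_joinx0 prim_join0x prim_meetx0 prim_meet0x
  prim_diffKl prim_diffKr prim_diffUl prim_diffUr prim_meetACA.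

Fact prim_cap_glb x y : is_glb x y (prim_cap x y).
Proof.
rewrite /is_glb /sle /smeet /=.
split; [split; by_prim | split; by_prim |].
move=> t [h1 h2] [h3 h4]; split; move: h1 h2 h3 h4; by_prim.
Qed.

HB.instance Definition _ := hasIntersections.Build (prim z) prim_cap_glb.

Fact prim_meet_lh x y : prim_meet (prim_meet x y) x = prim_meet x y.
Proof. by_prim. Qed.
Fact prim_join_lh x y : prim_join (prim_join x y) x = prim_join y x.
Proof. by_prim. Qed.

HB.instance Definition _ := isLeftHanded.Build (prim z) prim_meet_lh prim_join_lh.

End Primitive.

(** * Commutative algebras as left-handed SBIAs *)

Section CommutativeLeftHanded.
Variable S : sbaType.
Hypotheses (mC : commutative (@smeet S)) (jC : commutative (@sjoin S)).

Lemma comm_meet_lh (x y : S) : x ∧ y ∧ x = x ∧ y.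
Proof. by rewrite mC smeetA smeetxx. Qed.

Lemma comm_join_lh (x y : S) : x ∨ y ∨ x = y ∨ x.
Proof.
have jxx (t : S) : t ∨ t = t by rewrite -{2}(smeetxx t) sjoinKr.
by rewrite (jC x y) -sjoinA jxx.
Qed.

Lemma comm_meet_glb (x y : S) : is_glb x y (x ∧ y).
Proof.
split.
- by split; rewrite ?smeetA ?smeetxx // mC smeetA smeetxx.
- by split; rewrite ?(mC y) -?smeetA ?smeetxx.
- by move=> t [h1 h2] [h3 h4]; split; [rewrite smeetA h1|rewrite -smeetA h4].
Qed.

End CommutativeLeftHanded.

HB.instance Definition _ k := isLeftHanded.Build (pow2 k)
  (comm_meet_lh (@smeetC (pow2 k))) (comm_join_lh (@sjoinC (pow2 k))).

(** With [∧] as intersection, a GBA can be a target of the universal property of the free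
    left-handed SBIA. *)
Definition gba_sbia (G : gbaType) : Type := G.
HB.instance Definition _ (G : gbaType) := GBA.on (gba_sbia G).
HB.instance Definition _ (G : gbaType) := hasIntersections.Build (gba_sbia G)
  (comm_meet_glb (@smeetC G)).
HB.instance Definition _ (G : gbaType) := isLeftHanded.Build (gba_sbia G)
  (comm_meet_lh (@smeetC G)) (comm_join_lh (@sjoinC G)).

(** * Restriction and separation *)

Section LeftHandedTheory.
Variable S : sbiaType.
Hypothesis lh : forall x y : S, x ∧ y ∧ x = x ∧ y.
Implicit Types x y z c u v : S.

(** Left-handedness lets [x] be repeated at the right end, which makes [y] and [z] inner factors
    that may be exchanged. *)
Lemma lh_meetAC x y z : x ∧ y ∧ z = x ∧ z ∧ y.
Proof.
by rewrite -[LHS]smeetA -lh smeetA smeetACA -(smeetA x z) lh smeetA.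
Qed.

Lemma sle_meetr x c : x ∧ c ≤ x.
Proof. by split; rewrite ?lh // smeetA smeetxx. Qed.

Lemma sdiff_eq0 u v : u ∧ v = u -> u ∖ v = szero.
Proof.
move=> e; have [h _] := sle_diff u v.
by rewrite -h -[X in _ ∧ X]e smeetA lh_meetAC sdiffKl smeet0x.
Qed.

Lemma sdiffx0 u : u ∖ szero = u.
Proof. by have := sdiffUl u szero; rewrite smeetx0 smeet0x sjoinx0. Qed.

Lemma scap0x u : (szero : S) ⊓ u = szero.
Proof. by rewrite -scap_leL smeet0x. Qed.

Lemma scapx0 u : u ⊓ (szero : S) = szero.
Proof. by rewrite scapC scap0x. Qed.

Lemma scapxx u : u ⊓ u = u.
Proof.
case: (scap_glb u u) => h _ m; apply: sle_anti => //.
by apply: m; apply: sle_refl.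
Qed.

Definition restrict c x : S := x ∧ c.

Lemma restrict_meet c x y : restrict c (x ∧ y) = restrict c x ∧ restrict c y.
Proof.
by rewrite /restrict smeetA (lh_meetAC x c) -!smeetA smeetxx.
Qed.

Lemma restrict_join c x y : restrict c (x ∨ y) = restrict c x ∨ restrict c y.
Proof. exact: smeetUl. Qed.

(* [x ∖ y] is determined as the complement of [x ∧ y ∧ x] below [x]. *)
Lemma restrict_diff c x y : restrict c (x ∖ y) = restrict c x ∖ restrict c y.
Proof.
set X := restrict c x; set Y := restrict c y; set q := restrict c _.
set p := X ∖ Y.
have [dx _] := sle_diff x y.
have Eq : q ∨ X ∧ Y ∧ X = X.
  by rewrite -!restrict_meet -restrict_join sdiffUl.
have Ep : p ∨ X ∧ Y ∧ X = X by exact: sdiffUl.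
have qX : q ∧ X = q by rewrite -restrict_meet dx.
have Xp : X ∧ p = p by case: (sle_diff X Y).
have XYp : X ∧ Y ∧ X ∧ p = szero.
  by rewrite smeetACA -smeetA sdiffKr smeetx0.
have qXY : q ∧ (X ∧ Y ∧ X) = szero.
  by rewrite -!restrict_meet !smeetA dx sdiffKl smeet0x /restrict smeet0x.
(* [q ∧ p] is computed twice: expanding [X] in [q ∧ X] gives [q], expanding it in [X ∧ p] gives
   [p]. *)
have <- : q ∧ p = q by rewrite -{2}qX -[in RHS]Ep smeetUr qXY sjoinx0.
by rewrite -[RHS]Xp -[in RHS]Eq smeetUl XYp sjoinx0.
Qed.

(** Restriction is monotone, which gives one inequality. Conversely, the right-hand side lies below
    [x] and [y], hence below [x ⊓ y], and it absorbs [c]. *)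
Lemma restrict_cap c x y : restrict c (x ⊓ y) = restrict c x ⊓ restrict c y.
Proof.
have [h1 h2 h3] := scap_glb x y; have [k1 k2 k3] := scap_glb (x ∧ c) (y ∧ c).
have mono u v : u ≤ v -> u ∧ c ≤ v ∧ c.
  by move=> [a b]; split; rewrite -!/(restrict c _) -restrict_meet ?a ?b.
apply: sle_anti; first by apply: k3; apply: mono.
have -> : restrict c x ⊓ restrict c y = (restrict c x ⊓ restrict c y) ∧ c.
  by rewrite -scap_leR -smeetA {3}/restrict -(smeetA x) smeetxx.
apply: mono; apply: h3; apply: sle_trans (sle_meetr _ c); [exact: k1|exact: k2].
Qed.


Lemma restrict_hom c : sbia_hom (restrict c).
Proof.
split; last exact: restrict_cap.
split; [exact: restrict_meet|exact: restrict_join|exact: restrict_diff|].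
exact: smeet0x.
Qed.

(** Meet the current element with [y j] whenever the result is nonzero; the alternatives settled for
    other indices survive this. *)
Lemma shrink (J : eqType) (y : J -> S) (s : seq J) c : c <> szero ->
  exists c', [/\ c' <> szero, c' ∧ c = c'
    & {in s, forall j, c' ∧ y j = c' \/ c' ∧ y j = szero}].
Proof.
move=> c0; elim: s => [|j s [c' [c'0 c'c IH]]]; first by exists c; rewrite smeetxx.
have [e|e] := pselect (c' ∧ y j = szero).
  exists c'; split=> // k; rewrite inE => /predU1P[->|/IH //]; by right.
exists (c' ∧ y j); split; rewrite 1?lh_meetAC ?c'c // => k.
rewrite inE lh_meetAC => /predU1P[->|/IH[->|->]]; last by right; rewrite smeet0x.
  by left; rewrite -smeetA smeetxx.
by left.
Qed.

End LeftHandedTheory.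

(* The operations of a primitive algebra, on a family whose index [k0] names
   the zero. *)
Definition primitive_family (S : sbiaType) (K : Type) (k0 : K) (g : K -> S) : Prop :=
  [/\ g k0 = szero,
      forall k l, g l <> szero ->
        [/\ g k ∧ g l = g k, g k ∨ g l = g l & g k ∖ g l = szero]
    & forall k l, g k <> g l -> g k ⊓ g l = szero].

Lemma prim_primitive (T : eqType) (z : T) (K : Type) (k0 : K) (g : K -> prim z) :
  g k0 = szero -> primitive_family k0 g.
Proof.
split=> // k l; rewrite /szero /smeet /sjoin /sdiff /scap /=.
  by move=> /eqP/negPf h; rewrite /prim_meet /prim_join /prim_diff h.
by move=> /eqP/negPf h; rewrite /prim_cap h.
Qed.

(** * Transfer between primitive families with the same kernel *)

Section Agreement.
Variables (S T : sbiaType) (K : Type) (k0 : K) (g : K -> S) (h : K -> T).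
Hypotheses (gP : primitive_family k0 g) (hP : primitive_family k0 h).
Hypothesis same_kernel : forall k l, g k = g l <-> h k = h l.

Definition agree (x : S) (y : T) : Prop := exists2 k, x = g k & y = h k.

(** Each operation returns a member of the family, and which one depends only on whether [g l] is
    zero and whether [g k = g l]. Both are visible in the kernel. *)
Lemma agree_closed x y x' y' : agree x y -> agree x' y' ->
  [/\ agree (x ∧ x') (y ∧ y'), agree (x ∨ x') (y ∨ y'),
      agree (x ∖ x') (y ∖ y') & agree (x ⊓ x') (y ⊓ y')].
Proof.
have [g0 gp gc] := gP; have [h0 hp hc] := hP.
move=> [k -> ->] [l -> ->]; have [gl|gl] := pselect (g l = szero).
  have hl : h l = szero by rewrite -h0; apply/same_kernel; rewrite g0.
  rewrite gl hl !smeetx0 !sjoinx0 !sdiffx0 !scapx0.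
  by split; [exists k0|exists k|exists k|exists k0].
have hl : h l <> szero by rewrite -h0 => /same_kernel; rewrite g0.
have [-> -> ->] := gp k l gl; have [-> -> ->] := hp k l hl.
split; [by exists k|by exists l|by exists k0|].
have [e|e] := pselect (g k = g l).
  by have e' := e; move/same_kernel: e' => e'; exists k; rewrite ?e ?e' scapxx.
by exists k0; [rewrite gc|rewrite hc // => /same_kernel].
Qed.

End Agreement.

(** By uniqueness, the round trip from [F] through the term algebra is the identity. So every
    element is the value of a term, and induction on terms applies. *)
Lemma lsbia_ind (X : Type) (F : lsbiaType) (i : X -> F) (P : F -> Prop) :
  is_free_lsbia i -> (forall x, P (i x)) -> P szero ->
  (forall x y, P x -> P y ->
    [/\ P (x ∧ y), P (x ∨ y), P (x ∖ y) & P (x ⊓ y)]) ->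
  forall x, P x.
Proof.
move=> hF Pi P0 Pop.
have [h [[hs hc] hi _]] := hF (free_alg X lsbia_class) (@tgen X lsbia_class).
have [k [[[km kj kd kz] kc] ki _]] := free_lsbiaP i.
have [u [_ _ uniq_u]] := hF F i.
have kh x : k (h x) = x.
  transitivity (u x); last first.
    by apply/esym/(uniq_u id).
  have [hm hj hd hz] := hs; apply: (uniq_u (k \o h)) => [|y]; last first.
    by rewrite /= hi ki.
  by split; [split|] => * /=; rewrite ?hm ?hj ?hd ?hz ?hc.
move=> x; rewrite -(kh x); elim/tcls_ind: (h x) => {x}.
elim=> [x||s IHs t IHt|s IHs t IHt|s IHs t IHt|s IHs t IHt].
- by rewrite -/(tgen _ x) ki.
- by rewrite kz.
- by rewrite -tmeetE km; case: (Pop _ _ IHs IHt).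
- by rewrite -tjoinE kj; case: (Pop _ _ IHs IHt).
- by rewrite -tdiffE kd; case: (Pop _ _ IHs IHt).
- by rewrite -tcapE kc; case: (Pop _ _ IHs IHt).
Qed.

Lemma sba_hom_comp (R S T : sbaType) (g : S -> T) (f : R -> S) :
  sba_hom f -> sba_hom g -> sba_hom (g \o f).
Proof.
by move=> [fm fj fd f0] [gm gj gd g0]; split=> *; rewrite /= ?(fm, fj, fd, f0).
Qed.

Lemma sbia_hom_comp (R S T : sbiaType) (g : S -> T) (f : R -> S) :
  sbia_hom f -> sbia_hom g -> sbia_hom (g \o f).
Proof.
move=> [fs fc] [gs gc]; split; first exact: sba_hom_comp.
by move=> x y; rewrite /= fc gc.
Qed.

(** * Separation of two elements by a restriction *)

Section Separation.
Variables (n : nat) (S T : sbiaType) (i : 'I_n -> S) (h : S -> T).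
Hypotheses (lh : forall x y : T, x ∧ y ∧ x = x ∧ y) (h_hom : sbia_hom h).

(** The first alternative makes each restricted element zero or D-equivalent to [c]. By the second,
    restrictions with nonzero intersection both equal [(g k ⊓ g l) ∧ c]. *)
Lemma restrict_primitive (K : Type) (k0 : K) (g : K -> T) c : g k0 = szero ->
  (forall k, c ∧ g k = c \/ c ∧ g k = szero) ->
  (forall k l, c ∧ (g k ⊓ g l) = c \/ c ∧ (g k ⊓ g l) = szero) ->
  primitive_family k0 (fun k => restrict c (g k)).
Proof.
move=> g0 dec1 dec2.
have z k : c ∧ g k = szero -> restrict c (g k) = szero.
  by move=> e; rewrite /restrict -lh -smeetA e smeetx0.
split; first by rewrite g0 /restrict smeet0x.
- move=> k l nz.
  have e : c ∧ restrict c (g l) = c.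
    by rewrite /restrict smeetA lh; case: (dec1 l) => // /z.
  have kl : restrict c (g k) ∧ restrict c (g l) = restrict c (g k).
    by rewrite {1}/restrict -smeetA e.
  split=> //; last exact: sdiff_eq0.
  by have := sjoinKl (restrict c (g l)) (restrict c (g k)); rewrite kl.
- move=> k l ne; rewrite -restrict_cap // /restrict.
  case: (dec2 k l) => e; last by rewrite -lh -smeetA e smeetx0.
  case: ne; rewrite /restrict -e !smeetA !(lh_meetAC lh _ c) scap_leL.
  by rewrite scapC scap_leL.
Qed.

(** Restrict to a nonzero [c'] with [c' ∧ h a = c'] and [c' ∧ (h a ⊓ h b) = szero]: if [h a] and
    [h b] had equal restrictions, so would [h a] and [h a ⊓ h b]. Later [h] is the identity or the
    projection onto a commutative quotient. *)
Lemma separation a b : h a <> h b -> exists (r : S -> T) (g : 'I_n.+1 -> T),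
  [/\ sbia_hom r, primitive_family ord0 g, r a <> r b
    & forall j, r (i j) = g (lift ord0 j)].
Proof.
(* If both differences vanish, [h a] and [h b] both equal their intersection. *)
wlog nz : a b / h a ∖ (h a ⊓ h b) <> szero.
  move=> wl ab; have [ea|/wl] := pselect (h a ∖ (h a ⊓ h b) = szero); last exact.
  have [eb|/wl] := pselect (h b ∖ (h b ⊓ h a) = szero).
    have eqm x y : x ∖ (x ⊓ y) = szero -> x = x ⊓ y :> T.
      by move=> e; have := sdiffUl x (x ⊓ y); rewrite e sjoin0x lh scap_leL.
    by case: ab; rewrite (eqm _ _ ea) scapC -(eqm _ _ eb).
  case/(_ (nesym ab)) => r [g [h1 h2 h3 h4]].
  by exists r, g; split=> //; apply: nesym.
move=> _; set c := h a ∖ (h a ⊓ h b) in nz.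
pose g (k : 'I_n.+1) := oapp (h \o i) szero (unlift ord0 k).
(* The diagonal pairs take care of the generators themselves, since [g k ⊓ g k = g k]. *)
pose y (p : 'I_n.+1 * 'I_n.+1) := g p.1 ⊓ g p.2.
have [c' [c'0 c'c dec]] := shrink lh y (enum {: 'I_n.+1 * 'I_n.+1}) nz.
have {}dec k l : c' ∧ (g k ⊓ g l) = c' \/ c' ∧ (g k ⊓ g l) = szero.
  by apply: (dec (k, l)); rewrite mem_enum.
exists (restrict c' \o h), (fun k => restrict c' (g k)); split.
- by apply: sbia_hom_comp h_hom _; apply: restrict_hom.
- apply: restrict_primitive => // [|k]; first by rewrite /g unlift_none.
  by have := dec k k; rewrite scapxx.
- move=> /= e; have ca : c' ∧ h a = c'.
    by rewrite -c'c -smeetA; case: (sle_diff (h a) (h a ⊓ h b)) => ->.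
  have cab : c' ∧ (h a ⊓ h b) = szero by rewrite -c'c -smeetA sdiffKl smeetx0.
  have : restrict c' (h a ⊓ h b) = restrict c' (h a).
    by rewrite restrict_cap // e scapxx.
  move/(congr1 (smeet c')); rewrite /restrict !smeetA cab smeet0x ca smeetxx.
  by move/esym.
- by move=> j; rewrite /= /g liftK.
Qed.

End Separation.

(** * First isomorphism theorem *)

Lemma quot_iso (S T : sbaType) (c : sba_congruence S) (f : S -> T) :
  sba_hom f -> (forall x y, c x y <-> f x = f y) -> (forall y, exists x, f x = y) ->
  sba_iso (quot c) T.
Proof.
move=> [fm fj fd f0] fc surj.
have [g gK] := choice surj.
have fr x : f (rep (cls c x)) = f x by apply/fc/rep_cls.
exists (fun p => f (rep p)).
  exists (fun y => cls c (g y)) => [p|y]; last by rewrite fr gK.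
  by rewrite -[RHS]repK; apply/clsP/fc; rewrite gK.
by split=> [p q|p q|p q|]; rewrite ?fr.
Qed.

Lemma quot_sbia_iso (S T : sbiaType) (c : sbia_congruence S) (f : S -> T) :
  sbia_hom f -> (forall x y, c x y <-> f x = f y) -> (forall y, exists x, f x = y) ->
  sbia_iso (quot c) T.
Proof.
move=> [[fm fj fd f0] fcap] fc surj.
have [g gK] := choice surj.
have fr x : f (rep (cls c x)) = f x by apply/fc/rep_cls.
exists (fun p => f (rep p)).
  exists (fun y => cls c (g y)) => [p|y]; last by rewrite fr gK.
  by rewrite -[RHS]repK; apply/clsP/fc; rewrite gK.
by split; first split=> [p q|p q|p q|]; rewrite ?fr // => p q; rewrite fr.
Qed.

(** * Powers of [2] *)

Section Pow2Theory.
Variables (k : nat) (U : pow2 k -> Prop).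
Hypotheses (U0 : U szero)
  (Uop : forall u v, U u -> U v -> [/\ U (u ∧ v), U (u ∨ v) & U (u ∖ v)]).

(** Such a subalgebra contains every atom, and every element is a join of atoms. *)
Lemma pow2_full : (forall a, exists2 u, U u & u a) ->
  (forall a b, a != b -> exists2 u, U u & u a != u b) -> forall v, U v.
Proof.
move=> Ucov Usep.
(* Start from an element that is 1 at [a] and clear each other coordinate with a separating [w]: by
   a meet if [w a] holds, by a difference otherwise. *)
have atom a : exists2 u, U u & forall b, u b = (b == a).
  suff [u Uu [ua ub]] : exists2 u, U u &
      u a /\ {in enum 'I_k, forall b, b != a -> u b = false}.
    exists u => // b; case: eqVneq => [->//|]; apply: ub; exact: mem_enum.
  elim: (enum 'I_k) => [|b s [u Uu [ua us]]].
    by have [u Uu ua] := Ucov a; exists u.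
  have [->|ab] := eqVneq b a.
    exists u => //; split=> // d; rewrite inE => /predU1P[->|/us//].
    by rewrite eqxx.
  have [w Uw wab] := Usep _ _ ab; have [Um _ Ud] := Uop Uu Uw.
  have [wa|wa] := boolP (w a).
    exists (u ∧ w) => //; rewrite ffunE ua wa; split=> // d.
    rewrite inE ffunE => /predU1P[->|/us us' /us' ->//] _.
    by case: (w b) wab; rewrite ?wa ?andbF.
  exists (u ∖ w) => //; rewrite ffunE ua (negPf wa); split=> // d.
  rewrite inE ffunE => /predU1P[->|/us us' /us' ->//] _.
  by case: (w b) wab; rewrite ?(negPf wa) ?andbF.
move=> v; suff [u Uu uv] : exists2 u, U u &
    forall b, u b = (b \in enum 'I_k) && v b.
  suff -> : v = u by [].
  by apply/ffunP => b; rewrite uv mem_enum.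
elim: (enum 'I_k) => [|a s [u Uu us]].
  by exists szero => // b; rewrite ffunE.
have [w Uw wa] := atom a; have [_ Uj _] := Uop Uu Uw.
case va: (v a); last first.
  by exists u => // b; rewrite us inE; case: eqVneq => [->|//]; rewrite va !andbF.
exists (u ∨ w) => // b; rewrite ffunE us wa inE orbC.
by case: eqVneq => [->|//]; rewrite va.
Qed.

End Pow2Theory.

(** [None] stands for the zero homomorphism. If an atom goes to 1, [u] is the coordinate at that
    atom; otherwise [pow2_full], applied to the elements sent to 0, shows that [u] vanishes. *)
Lemma pow2_hom_coord k (u : pow2 k -> pow2 1) : sba_hom u ->
  exists o : option 'I_k, forall z, u z ord0 = oapp z false o.
Proof.
move=> [um uj ud u0].
pose atom a : pow2 k := [ffun b => b == a].
have [[a ua]|all0] := pselect (exists a, u (atom a) ord0).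
  exists (Some a) => z /=; case za: (z a).
    have : u (z ∧ atom a) ord0.
      suff -> : z ∧ atom a = atom a by [].
      by apply/ffunP => b; rewrite !ffunE; case: eqP => [->|]; rewrite ?za ?andbF.
    by rewrite um ffunE => /andP[].
  have : u (z ∧ atom a) ord0 = false.
    suff -> : z ∧ atom a = szero by rewrite u0 ffunE.
    by apply/ffunP => b; rewrite !ffunE; case: eqP => [->|]; rewrite ?za ?andbF.
  by rewrite um ffunE ua andbT.
exists None => z /=; move: z.
have a0 a : u (atom a) ord0 = false.
  by apply/negP => ua; apply: all0; exists a.
apply: pow2_full; first by rewrite u0 ffunE.
- by move=> v w h1 h2; rewrite um uj ud !ffunE h1 h2.
- by move=> a; exists (atom a); rewrite ?ffunE ?eqxx.
- move=> a b ab; exists (atom a); rewrite // !ffunE eqxx.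
  by rewrite (eq_sym b) (negPf ab).
Qed.

Lemma zero_hom (S T : sbiaType) : sbia_hom (fun _ : S => szero : T).
Proof. by split; [split|] => *; rewrite ?smeetx0 ?sjoinx0 ?sdiffx0 ?scapx0. Qed.

(** The target is the algebra 2 in its primitive form, for comparison with homomorphisms built from
    primitive families. *)
Lemma coord_hom k (a : 'I_k) : sbia_hom (fun v : pow2 k => v a : prim false).
Proof.
have m (u v : pow2 k) : (u ∧ v) a = (u a : prim false) ∧ v a.
  by rewrite ffunE /smeet /= /prim_meet; case: (u a); case: (v a).
split; [split|] => // [u v|u v||u v].
- by rewrite ffunE /sjoin /= /prim_join; case: (u a); case: (v a).
- by rewrite ffunE /sdiff /= /prim_diff; case: (u a); case: (v a).
- by rewrite ffunE.
- rewrite [u ⊓ v]/(u ∧ v) m /smeet /scap /= /prim_meet /prim_cap.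
  by case: (u a); case: (v a).
Qed.

(** * The maximal commutative quotient *)

Section KernelCongruence.
Variables (S T : sbiaType) (f : S -> T).
Hypothesis f_hom : sbia_hom f.

Definition ker_rel (x y : S) : Prop := f x = f y.

Fact ker_meet x x' y y' : ker_rel x x' -> ker_rel y y' -> ker_rel (x ∧ y) (x' ∧ y').
Proof. rewrite /ker_rel; case: f_hom => -[e _ _ _] _ h k; by rewrite !e h k. Qed.
Fact ker_join x x' y y' : ker_rel x x' -> ker_rel y y' -> ker_rel (x ∨ y) (x' ∨ y').
Proof. rewrite /ker_rel; case: f_hom => -[_ e _ _] _ h k; by rewrite !e h k. Qed.
Fact ker_diff x x' y y' : ker_rel x x' -> ker_rel y y' -> ker_rel (x ∖ y) (x' ∖ y').
Proof. rewrite /ker_rel; case: f_hom => -[_ _ e _] _ h k; by rewrite !e h k. Qed.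
Fact ker_cap x x' y y' : ker_rel x x' -> ker_rel y y' -> ker_rel (x ⊓ y) (x' ⊓ y').
Proof. rewrite /ker_rel; case: f_hom => _ e h k; by rewrite !e h k. Qed.

Definition ker_congr : sbia_congruence S :=
  @SBIACongruence S
    (@SBACongruence S ker_rel (fun=> erefl) (fun x y => @esym _ _ _)
      (fun y x z => @etrans _ _ _ _) ker_meet ker_join ker_diff) ker_cap.

Lemma min_comm_ker : sba_commutative T -> forall x y, min_comm_rel x y -> f x = f y.
Proof.
move=> [mC jC] x y; apply: (min_comm_congr_min (c := ker_congr)).
have [[fm fj _ _] _] := f_hom.
split=> p q; rewrite -(repK p) -(repK q).
  by rewrite [LHS]qmeetE [RHS]qmeetE; apply/clsP; rewrite /= /ker_rel !fm mC.
by rewrite [LHS]qjoinE [RHS]qjoinE; apply/clsP; rewrite /= /ker_rel !fj jC.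
Qed.

End KernelCongruence.

(** * Coordinates indexed by nonempty sets of generators *)

Section FreeSpectrum.
Variables (n : nat) (F : lsbiaType) (i : 'I_n -> F).
Hypothesis hF : is_free_lsbia i.

(** By induction over the free algebra, [r x] and [e x] are members with a common index; equality of
    kernels does the rest. *)
Lemma agree_sep (S T : sbiaType) (r : F -> S) (e : F -> T)
    (g : 'I_n.+1 -> S) (h : 'I_n.+1 -> T) :
  primitive_family ord0 g -> primitive_family ord0 h ->
  (forall k l, g k = g l <-> h k = h l) -> sbia_hom r -> sbia_hom e ->
  (forall j, r (i j) = g (lift ord0 j)) -> (forall j, e (i j) = h (lift ord0 j)) ->
  forall a b, r a <> r b -> e a <> e b.
Proof.
move=> gP hP same [[rm rj rd r0] rc] [[em ej ed e0] ec] ri ei a b.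
have ag x : agree g h (r x) (e x).
  move: x; apply: (lsbia_ind hF) => [j||x y hx hy].
  - by exists (lift ord0 j).
  - by case: gP hP => g0 _ _ [h0 _ _]; exists ord0; rewrite ?r0 ?e0 ?g0 ?h0.
  - by rewrite rm em rj ej rd ed rc ec; apply: (agree_closed gP hP same).
have [k -> ->] := ag a; have [l -> ->] := ag b.
by move=> ne /same.
Qed.

Definition nonzero_funs : {set {ffun 'I_n -> bool}} := ~: [set [ffun=> false]].

Lemma card_nonzero_funs : #|nonzero_funs| = (2 ^ n).-1.
Proof.
by rewrite cardsC1 card_ffun card_bool card_ord.
Qed.

Local Notation N := #|nonzero_funs|.

Definition nonzero_fun (a : 'I_N) : {ffun 'I_n -> bool} := enum_val a.

(** The coordinates are the nonzero homomorphisms to 2. If a commutative quotient separates [x] and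
    [y], [separation] yields a homomorphism to 2 that separates them, and this is one of the
    coordinates. *)
Lemma comm_coords : exists E : F -> pow2 N,
  [/\ sbia_hom E, forall j, E (i j) = [ffun a : 'I_N => nonzero_fun a j],
    forall v, exists x, E x = v & forall x y, min_comm_rel x y <-> E x = E y].
Proof.
have [E [E_hom Ei _]] := hF (fun j => [ffun a : 'I_N => nonzero_fun a j] : pow2 N).
exists E; split=> //.
  have [[Em Ej Ed E0] _] := E_hom.
  apply: (@pow2_full N (fun v => exists x, E x = v)).
  - by exists szero.
  - move=> _ _ [x <-] [y <-].
    by split; [exists (x ∧ y)|exists (x ∨ y)|exists (x ∖ y)].
  - move=> a; have [j aj] : exists j, nonzero_fun a j.
      apply: contrapT => a0; have := enum_valP a; rewrite !inE => /negP; apply.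
      by apply/eqP/ffunP => j; rewrite ffunE; apply/negP => aj; apply: a0; exists j.
    by exists (E (i j)); [exists (i j)|rewrite Ei ffunE].
  - move=> a b ab; have [j aj] : exists j, nonzero_fun a j != nonzero_fun b j.
      apply: contrapT => a0; move/eqP: ab; apply; apply/enum_val_inj/ffunP => j.
      by apply/eqP/negPn/negP => aj; apply: a0; exists j.
    by exists (E (i j)); [exists (i j)|rewrite Ei !ffunE].
move=> x y; split.
  by apply: min_comm_ker => //; split; [exact: smeetC|exact: sjoinC].
move=> Exy c cC; apply/clsP; apply: contrapT => nxy.
have lh (p q : quot c) : p ∧ q ∧ p = p ∧ q by apply: comm_meet_lh; case: cC.
have [r [g [r_hom gP rxy rg]]] := separation i lh (icls_hom c) nxy.
(* In a commutative algebra the nonzero members of a primitive family coincide, as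
   [g k = g k ∧ g l = g l ∧ g k = g l]. So [h] has the kernel of [g]. *)
pose h k : prim false := `[< g k <> szero >].
have h0 : h ord0 = szero.
  by case: gP => g0 _ _; apply: asboolF; rewrite g0 => /(_ erefl).
have [e [e_hom ei e_uniq]] := hF (fun j => h (lift ord0 j)).
have same k l : g k = g l <-> h k = h l.
  split=> [e1|]; first by rewrite /h e1.
  have [_ gm _] := gP; rewrite /h => hkl.
  have kl : g k <> szero <-> g l <> szero.
    by split=> /asboolP b; apply/asboolP; move: b; rewrite hkl.
  have [l0|l0] := pselect (g l = szero).
    by rewrite l0; apply: contrapT => /kl /(_ l0).
  have k0 : g k <> szero by apply/kl.
  have [e1 _ _] := gm k l l0; have [e2 _ _] := gm l k k0.
  by rewrite -e1 -{2}e2; case: cC => ->.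
have exy : e x <> e y.
  exact: (agree_sep gP (prim_primitive h0) same r_hom e_hom rg ei rxy).
(* If [f] were zero, [e] would be the zero homomorphism and could not separate [x] from [y]. *)
pose f : {ffun 'I_n -> bool} := [ffun j : 'I_n => h (lift ord0 j) : bool].
have fN : f \in nonzero_funs.
  rewrite !inE; apply/eqP => f0; apply: exy.
  have hj (j : 'I_n) : false = h (lift ord0 j).
    by move/ffunP/(_ j): (f0); rewrite !ffunE.
  have e0 := e_uniq _ (zero_hom F _) hj.
  by rewrite -!e0.
apply: exy; pose a := enum_rank_in fN f.
have ea := e_uniq _ (sbia_hom_comp E_hom (coord_hom a)).
rewrite -!ea /= ?Exy // => j.
all: by rewrite Ei ffunE /nonzero_fun enum_rankK_in // ffunE.
Qed.

Lemma max_comm_quot_iso : sbia_iso (quot (min_comm_congr F)) (pow2 N).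
Proof.
have [E [E_hom _ E_surj E_ker]] := comm_coords.
exact: (quot_sbia_iso (c := min_comm_congr F) E_hom E_ker E_surj).
Qed.

(** The map [q] factors through [E], whose kernel is the smallest congruence with commutative
    quotient. The factor [s] is inverse to the map [p] given by the freeness of [G]. *)
Lemma free_gba_iso (G : gbaType) (j : 'I_n -> G) :
  is_free_gba j -> sba_iso (pow2 N) G.
Proof.
move=> hG; have [E [E_hom Ei E_surj E_ker]] := comm_coords.
have [q [q_hom qi _]] := hF (j : 'I_n -> gba_sbia G).
have [p [p_hom pj _]] := hG (pow2 N) (E \o i).
have pq x : p (q x) = E x.
  have [u [_ _ uU]] := hF (E \o i).
  have pq_hom : sbia_hom (p \o q : F -> pow2 N).
    by have [pm _ _ _] := p_hom; apply: (sbia_hom_comp q_hom); split.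
  by rewrite (uU E) // -(uU (p \o q)) //= => k; rewrite /= qi pj.
have [g gK] := choice E_surj.
have qE x y : E x = E y -> q x = q y.
  by move/E_ker; apply: min_comm_ker => //; split; [exact: smeetC|exact: sjoinC].
pose s v : G := q (g v).
have [[qm qj qd q0] _] := q_hom; have [[Em Ej Ed E0] _] := E_hom.
have s_hom : sba_hom s.
  split=> [u v|u v|u v|]; rewrite /s -?qm -?qj -?qd -?q0; apply: qE;
    by rewrite ?Em ?Ej ?Ed ?E0 !gK.
exists s => //; exists p => v; first by rewrite pq gK.
have [u [_ _ uU]] := hG G j.
transitivity (u v); last by apply/esym/(uU id).
apply: (uU (s \o p)); first exact: sba_hom_comp p_hom s_hom.
by move=> x; rewrite /= pj /= /s -qi; apply: qE; rewrite gK.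
Qed.

End FreeSpectrum.

(** * The quotient by [Drel] *)

Lemma partition_ext (T : finType) (P Q : {set {set T}}) :
  partition P setT -> partition Q setT ->
  (forall x y, (pblock P x == pblock P y) = (pblock Q x == pblock Q y)) -> P = Q.
Proof.
move=> pP pQ e.
have sub R x y : partition R [set: T] ->
    (y \in pblock R x) = (pblock R x == pblock R y).
  by move=> /and3P[/eqP cR tR _]; rewrite eq_pblock ?cR.
rewrite -(equivalence_partition_pblock pP) -(equivalence_partition_pblock pQ).
by apply: eq_imset => x; apply/setP => y; rewrite !inE /= !sub // e.
Qed.

(** * Homomorphisms indexed by partitions of the generators with 0 *)

Section PartitionSpectrum.
Variables (n : nat) (F : lsbiaType) (i : 'I_n -> F).
Hypothesis hF : is_free_lsbia i.

(** The block of 0 is the zero. The carrier consists of all subsets, but generators go to their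
    blocks. *)
Definition block_alg (P : {set {set 'I_n.+1}}) : lsbiaType := prim (pblock P ord0).

Lemma block_hom_exists P : exists e : F -> block_alg P,
  sbia_hom e /\ forall j, e (i j) = pblock P (lift ord0 j).
Proof.
have [e [e_hom ei _]] := hF (fun j => pblock P (lift ord0 j) : block_alg P).
by exists e.
Qed.

Definition block_hom P : F -> block_alg P := projT1 (cid (block_hom_exists P)).

Lemma block_hom_hom P : sbia_hom (block_hom P).
Proof. by case: (projT2 (cid (block_hom_exists P))). Qed.

Lemma block_hom_gen P j : block_hom P (i j) = pblock P (lift ord0 j).
Proof. by have [_ e] := projT2 (cid (block_hom_exists P)); apply: e. Qed.

(** A primitive family separating [a] from [b] has a kernel partition [P], and [block_hom P]
    separates them as well. *)
Lemma block_hom_sep a b :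
  (forall P, partition P setT -> block_hom P a = block_hom P b) -> a = b.
Proof.
move=> eab; apply: contrapT => nab.
have id_hom : sbia_hom (@id F) by split; first split.
have [r [g [r_hom gP rab rg]]] := separation i (@smeet_lh F) id_hom nab.
pose R := [rel k l : 'I_n.+1 | `[< g k = g l >]].
have R_equiv : {in setT & &, equivalence_rel R}.
  move=> k l m _ _ _; split; first exact/asboolP.
  by move=> /asboolP e; rewrite /= e.
pose P := equivalence_partition R setT.
have PP : partition P setT := equivalence_partitionP R_equiv.
have same k l : g k = g l <-> pblock P k = pblock P l.
  have /and3P[/eqP cP tP _] := PP.
  have e : (pblock P k == pblock P l) = `[< g k = g l >].
    by rewrite eq_pblock ?cP // pblock_equivalence_partition ?inE.
  split=> [h|/eqP]; last by rewrite e => /asboolP.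
  by apply/eqP; rewrite e; apply/asboolP.
have blocksP : primitive_family ord0 (pblock P : 'I_n.+1 -> block_alg P).
  exact: prim_primitive.
exact: (agree_sep hF gP blocksP same r_hom (block_hom_hom P) rg
  (block_hom_gen P) rab) (eab P PP).
Qed.

(** This is [block_hom P] modulo D, since all nonzero elements of a primitive algebra are
    D-equivalent. *)
Definition support P (x : F) : bool := block_hom P x != pblock P ord0.

Lemma support_ops P x y :
  [/\ support P (x ∧ y) = support P x && support P y,
      support P (x ∨ y) = support P x || support P y,
      support P (x ∖ y) = support P x && ~~ support P y
    & support P szero = false].
Proof.
have [[em ej ed e0] _] := block_hom_hom P.
rewrite /support em ej ed e0 eqxx /smeet /sjoin /sdiff /=.
rewrite /prim_meet /prim_join /prim_diff.
split=> //; case: (eqVneq (block_hom P y) (pblock P ord0)) => [e|/negPf e] /=;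
  by rewrite ?andbF ?andbT ?orbT ?orbF ?eqxx ?e.
Qed.

Lemma Drel_support x y :
  Drel x y <-> forall P, partition P setT -> support P x = support P y.
Proof.
have le u v : (forall P, partition P setT -> support P u = support P v) ->
    u ∧ v ∧ u = u.
  move=> e; apply: block_hom_sep => P pP; have := e P pP.
  have [[em _ _ _] _] := block_hom_hom P; rewrite !em /smeet /= /prim_meet /support.
  case: (eqVneq (block_hom P u) (pblock P ord0)) => [->//|_ /esym].
  by case: eqVneq.
split=> [[h1 h2] P _|e]; last by split; apply: le => // P /e.
have half u v : u ∧ v ∧ u = u -> support P u -> support P v.
  have [e1 _ _ _] := support_ops P (u ∧ v) u; have [e2 _ _ _] := support_ops P u v.
  by move=> <-; rewrite e1 e2 => /andP[/andP[]].
by apply/idP/idP; apply: half.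
Qed.

(** The support of [i j] tells whether [j] lies in the block of 0; the support of [i j ⊓ i l] tells
    whether [j] and [l] share a block other than that one. *)
Lemma support_partition P Q : partition P setT -> partition Q setT ->
  (forall x, support P x = support Q x) -> P = Q.
Proof.
move=> pP pQ e; apply: partition_ext => //.
have e0 j : (pblock P (lift ord0 j) == pblock P ord0) =
    (pblock Q (lift ord0 j) == pblock Q ord0).
  by have := e (i j); rewrite /support !block_hom_gen => /negb_inj.
have ee j l : (pblock P (lift ord0 j) == pblock P (lift ord0 l)) =
    (pblock Q (lift ord0 j) == pblock Q (lift ord0 l)).
  have capE R : support R (i j ⊓ i l) =
      (pblock R (lift ord0 j) == pblock R (lift ord0 l)) &&
      (pblock R (lift ord0 j) != pblock R ord0).
    have [_ ec] := block_hom_hom R.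
    rewrite /support ec !block_hom_gen /scap /= /prim_cap.
    by case: ifP => //; rewrite eqxx.
  have := e (i j ⊓ i l); rewrite !capE e0.
  (* If [j] lies in the block of 0, the claim reduces to [e0]; otherwise the intersection decides
     it. *)
  case: (eqVneq (pblock Q (lift ord0 j)) (pblock Q ord0)) => [eQ|_];
    rewrite ?andbT // => _.
  have /eqP eP : pblock P (lift ord0 j) == pblock P ord0 by rewrite e0 eQ eqxx.
  by rewrite eQ eP ![pblock _ ord0 == _]eq_sym e0.
move=> x y; case: (unliftP ord0 x) => [j ->|->]; case: (unliftP ord0 y) => [l ->|->] //.
  by rewrite ![pblock _ ord0 == _]eq_sym.
by rewrite !eqxx.
Qed.

(** With a single block every generator becomes zero, so this partition gives no coordinate: hence
    the [.-1] in the exponent. *)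
Definition trivial_partition : {set {set 'I_n.+1}} := [set setT].

Lemma trivial_partitionP : partition trivial_partition setT.
Proof.
apply/and3P; split; first by rewrite /cover big_set1.
  by apply/trivIsetP => A B /set1P-> /set1P->; rewrite eqxx.
by rewrite inE; apply/eqP => /setP/(_ ord0); rewrite !inE.
Qed.

Lemma support_trivial x : support trivial_partition x = false.
Proof.
have pb k : pblock trivial_partition k = setT.
  have /and3P[_ tP _] := trivial_partitionP.
  by apply: def_pblock => //; rewrite inE.
move: x; apply: (lsbia_ind hF) => [j||x y hx hy].
- by rewrite /support block_hom_gen !pb eqxx.
- by case: (support_ops trivial_partition szero szero).
- have [-> -> -> _] := support_ops trivial_partition x y; rewrite hx hy; split=> //.
  have [h _ _] := scap_glb x y; case: h => <- _.
  by have [-> _ _ _] := support_ops trivial_partition (x ⊓ y) x; rewrite hx andbF.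
Qed.

Definition proper_partitions : {set {set {set 'I_n.+1}}} :=
  [set P | partition P setT] :\ trivial_partition.

Lemma card_proper_partitions : #|proper_partitions| = (Bell n.+1).-1.
Proof.
by rewrite /Bell [in RHS](cardsD1 trivial_partition) inE trivial_partitionP.
Qed.

Local Notation M := #|proper_partitions|.

(** The supports at the proper partitions are coordinates with kernel D. They are nonzero and
    pairwise distinct by [support_partition], so [pow2_full] gives surjectivity. *)
Lemma D_quot_iso : sba_iso (quot (Dcongr F)) (pow2 M).
Proof.
pose th x : pow2 M := [ffun a : 'I_M => support (enum_val a) x].
have th_hom : sba_hom th.
  by split=> [x y|x y|x y|]; apply/ffunP => a; rewrite !ffunE;
    [case: (support_ops (enum_val a) x y)..|
     case: (support_ops (enum_val a) szero szero)].
have [thm thj thd th0] := th_hom.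
have part (a : 'I_M) : partition (enum_val a : {set {set 'I_n.+1}}) setT.
  by have := enum_valP a; rewrite !inE => /andP[].
apply: (quot_iso th_hom) => [x y|].
  split=> [/Drel_support e|/ffunP e]; last (apply/Drel_support => P pP).
    by apply/ffunP => a; rewrite !ffunE e.
  have [->|nP] := eqVneq P trivial_partition; first by rewrite !support_trivial.
  have PM : P \in proper_partitions by rewrite !inE nP.
  by have := e (enum_rank_in PM P); rewrite !ffunE enum_rankK_in.
apply: pow2_full.
- by exists szero.
- by move=> _ _ [x <-] [y <-]; split; [exists (x ∧ y)|exists (x ∨ y)|exists (x ∖ y)].
- move=> a; suff [x ax] : exists x, support (enum_val a) x.
    by exists (th x); [exists x|rewrite ffunE].
  apply: contrapT => a0; have := enum_valP a; rewrite !inE => /andP[/eqP + _]; apply.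
  apply: support_partition => // [|x]; first exact: trivial_partitionP.
  by rewrite support_trivial; apply/negbTE/negP => ax; apply: a0; exists x.
- move=> a b ab.
  suff [x ax] : exists x, support (enum_val a) x != support (enum_val b) x.
    by exists (th x); [exists x|rewrite !ffunE].
  apply: contrapT => a0; move/eqP: ab; apply; apply: enum_val_inj.
  apply: support_partition => // x; apply: contrapT => /eqP ax.
  by apply: a0; exists x.
Qed.

End PartitionSpectrum.

(* Count the homomorphisms to [2]: there are [k.+1] of them on [2^k], and as
   many as subsets of [X] on the free algebra over [X]. *)
Lemma free_gba_pow2 k (X : Type) (G : gbaType) (j : X -> G) :
  is_free_gba j -> sba_iso (pow2 k) G -> exists m, k.+1 = 2 ^ m.
Proof.
move=> hG [phi [psi phiK psiK] phi_hom].
have psi_hom : sba_hom psi.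
  have [m jn d z] := phi_hom.
  by split=> [x y|x y|x y|]; apply: (can_inj phiK); rewrite ?m ?jn ?d ?z !psiK.
(* [X] may be any type; its image in [pow2 k] is finite, and homomorphisms to 2 correspond to
   subsets of that image. *)
pose A := [set v : pow2 k | `[< exists x, v = psi (j x) >]].
have Aj x : psi (j x) \in A by rewrite inE; apply/asboolP; exists x.
pose th (o : option 'I_k) := [set v in A | oapp (v : pow2 k) false o].
exists #|A|; rewrite -card_powerset -[k in LHS]card_ord -card_option.
(* Homomorphisms that agree on the generators are equal, and distinct options give distinct
   homomorphisms. *)
have th_inj : injective th.
  pose co (o : option 'I_k) (z : pow2 k) : pow2 1 := [ffun => oapp z false o].
  have co_hom o : sba_hom (co o).
    by case: o => [a|]; split=> [x y|x y|x y|]; apply/ffunP => b;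
      rewrite !ffunE /= ?ffunE.
  move=> o o' eo; have eco z : co o z = co o' z.
    have [u [_ _ uU]] := hG (pow2 1) (fun x => co o (psi (j x))).
    rewrite -(phiK z) -[LHS]/((co o \o psi) _) -[RHS]/((co o' \o psi) _).
    rewrite !uU //; try exact: sba_hom_comp.
    move=> x; apply/ffunP => b; rewrite !ffunE.
    by move/setP/(_ (psi (j x))): eo; rewrite !inE; case: asboolP => // -[]; exists x.
  have atom (z : pow2 k) : oapp z false o = oapp z false o'.
    by have /ffunP/(_ ord0) := eco z; rewrite !ffunE.
  case: o o' {eo eco} atom => [a|] [b|] //= atom.
  - have := atom [ffun c => c == a]; rewrite !ffunE eqxx => /esym/eqP->//.
  - by have := atom [ffun => true]; rewrite ffunE.
  - by have := atom [ffun => true]; rewrite ffunE.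
rewrite -cardsT -(card_imset _ th_inj); apply: eq_card => B.
rewrite powersetE; apply/imsetP/idP => [[o _ ->]|BA].
  by apply/subsetP => z; rewrite inE => /andP[].
(* Freeness extends the characteristic function of [B] to a homomorphism, which is a coordinate or
   zero. *)
have [u [u_hom uj _]] := hG (pow2 1) (fun x => [ffun => psi (j x) \in B]).
have [o uo] := pow2_hom_coord (sba_hom_comp phi_hom u_hom).
exists o => //; apply/setP => z; rewrite [RHS]inE.
have [zA|zA] /= := boolP (z \in A); last first.
  by apply/negbTE; apply: contra zA; apply/subsetP.
move: zA; rewrite inE => /asboolP[x ->].
by rewrite -uo /= psiK uj ffunE.
Qed.


(** * Bell numbers modulo 8 *)

(* The number of ways to distribute [n] elements among [k] given blocks and
   any number of new ones. *)
Fixpoint urn (n k : nat) : nat :=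
  if n is n'.+1 then k * urn n' k + urn n' k.+1 else 1.

Lemma setD1_notin (T : finType) (A : {set T}) x : x \notin A -> A :\ x = A.
Proof. by move=> xA; apply/setDidPl; rewrite disjoint_sym disjoints1. Qed.

(** * Partitions of a set with one more point *)

Section AddPoint.
Variables (T : finType) (D : {set T}) (x : T).
Hypothesis xD : x \notin D.
Implicit Types (P Q : {set {set T}}) (o : {set T}).

(* [x] joins the block [o] of [P], or forms a new block if [o] is empty. *)
Definition add_point P o := (x |: o) |: (P :\ o).

(** Inverse of [add_point]; the second component is empty exactly when [x] forms a block alone. *)
Definition del_point Q :=
  let o := pblock Q x :\ x in
  let P := Q :\ pblock Q x in (if o == set0 then P else o |: P, o).

Lemma del_pointP Q (p := del_point Q) : partition Q (x |: D) ->
  [/\ partition p.1 D, p.2 \in set0 |: p.1 & add_point p.1 p.2 = Q].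
Proof.
move=> pQ; have /and3P[/eqP cQ tQ Q0] := pQ.
have xB : x \in pblock Q x by rewrite mem_pblock cQ setU11.
have BQ : pblock Q x \in Q by rewrite pblock_mem // cQ setU11.
rewrite /p /del_point /=; move: (pblock Q x) xB BQ => B xB BQ.
have BD : B \subset x |: D by rewrite -cQ; apply: bigcup_sup.
have pP := partitionD1 pQ BQ.
have xBB : x |: B :\ x = B by rewrite setD1K.
have DB : (x |: D) :\: B = D :\: (B :\ x).
  apply/setP => y; rewrite !inE; case: (eqVneq y x) => [->|] //=.
  by rewrite xB (negPf xD).
have oD : B :\ x \subset D by rewrite subDset.
have P0 : set0 \notin Q :\ B by case/and3P: pP.
rewrite /add_point xBB; case: eqVneq => [o0|o0].
  split; last by rewrite o0 setD1_notin // setD1K.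
    by rewrite -(setD0 D) -o0 -DB.
  by rewrite o0 setU11.
have oP : B :\ x \notin Q :\ B.
  apply/negP => oP; case/set0Pn: o0 => y yo.
  have : y \in cover (Q :\ B) by apply/bigcupP; exists (B :\ x).
  case/and3P: pP => /eqP-> _ _; rewrite inE => /andP[/negP[]].
  by case/setD1P: yo.
split; last by rewrite setU1K // setD1K.
  have -> : D = (B :\ x) :|: (x |: D) :\: B.
    by rewrite DB -{1}(setID D (B :\ x)) (setIidPr oD).
  apply: partitionU1 => //; rewrite DB -setI_eq0; apply/eqP/setP => y.
  by rewrite !inE; case: eqP; case: (y \in B).
by rewrite !inE eqxx orbT.
Qed.

Lemma add_pointP P o (Q := add_point P o) : partition P D -> o \in set0 |: P ->
  [/\ partition Q (x |: D), del_point Q = (P, o)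
    & #|Q| = if o == set0 then #|P|.+1 else #|P|].
Proof.
move=> pP oP; have /and3P[/eqP cP tP P0] := pP.
have oD : o \subset D.
  case/setU1P: oP => [->|oP]; first exact: sub0set.
  by rewrite -cP; apply: bigcup_sup.
have xo : x \notin o by apply: contra xD; apply: subsetP.
have pPo : partition (P :\ o) (D :\: o).
  case/setU1P: oP => [->|]; last exact: partitionD1.
  by rewrite setD0 setD1_notin.
have xoP : x |: o \notin P :\ o.
  apply/negP => /setD1P[_ h]; case/negP: xD; rewrite -cP.
  by apply/bigcupP; exists (x |: o); rewrite ?setU11.
have pQ : partition Q (x |: D).
  have -> : x |: D = (x |: o) :|: (D :\: o).
    by rewrite -setUA -{1}(setID D o) (setIidPr oD).
  apply: partitionU1 => //; first by apply/set0Pn; exists x; rewrite setU11.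
  rewrite -setI_eq0; apply/eqP/setP => y; rewrite !inE.
  by case: eqP => [->|_]; [rewrite (negPf xD) andbF|case: (y \in o)].
have pb : pblock Q x = x |: o.
  by apply: def_pblock; rewrite ?setU11 //; case/and3P: pQ.
split=> //.
  rewrite /del_point pb setU1K // /Q /add_point setU1K //.
  case: eqVneq => [->|o0].
    by rewrite setD1_notin.
  by case/setU1P: oP => [o0'|oP]; [rewrite o0' eqxx in o0|rewrite setD1K].
rewrite /Q cardsU1 xoP; case: eqVneq => [->|o0].
  by rewrite setD1_notin.
by case/setU1P: oP => [o0'|oP]; [rewrite o0' eqxx in o0|rewrite [in RHS](cardsD1 o) oP].
Qed.

(** The point [x] either joins one of the [#|P|] blocks, keeping their number, or opens a new
    one. *)
Lemma sum_partition_setU1 (f : nat -> nat) :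
  \sum_(Q : {set {set T}} | partition Q (x |: D)) f #|Q| =
  \sum_(P : {set {set T}} | partition P D) (#|P| * f #|P| + f #|P|.+1).
Proof.
rewrite (reindex_onto (fun p => add_point p.1 p.2) del_point) => [|Q pQ]; last first.
  by case: (del_pointP pQ).
transitivity (\sum_(p | partition p.1 D && (p.2 \in set0 |: p.1)) f #|add_point p.1 p.2|).
  apply: eq_bigl => -[P o] /=; apply/andP/andP => [[pQ /eqP e]|[pP oP]].
    by case: (del_pointP pQ); rewrite e.
  by case: (add_pointP pP oP) => ? -> _; rewrite eqxx.
rewrite -(pair_big_dep (fun P => partition P D) (fun P o => o \in set0 |: P)
  (fun P o => f #|add_point P o|)) /=; apply: eq_bigr => P pP.
have P0 : set0 \notin P by case/and3P: pP.
rewrite big_setU1 //= addnC -sum_nat_const; congr (_ + _); last first.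
  by case: (add_pointP pP (setU11 _ _)) => _ _ ->; rewrite eqxx.
apply: eq_bigr => o oP; case: (add_pointP pP (setU1r _ oP)) => _ _ ->.
by case: eqP => // o0; rewrite -o0 oP in P0.
Qed.

End AddPoint.

(** Partition [D] first, then distribute [k] more elements. Removing a point from [D] and raising
    [k] by one is the recursion of [urn]. *)
Lemma sum_partition_urn (T : finType) (D : {set T}) k :
  \sum_(P : {set {set T}} | partition P D) urn k #|P| = urn (k + #|D|) 0.
Proof.
elim: {D}#|D| {-2}D (erefl #|D|) k => [|m IH] D cD k.
  move/cards0_eq: cD => ->; rewrite (big_pred1 set0) => [|P]; last exact: partition_set0.
  by rewrite !cards0 addn0.
have [x xD] : exists x, x \in D by apply/set0Pn; rewrite -card_gt0 cD.
have cDx : #|D :\ x| = m by move: cD; rewrite (cardsD1 x) xD => -[].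
rewrite -(setD1K xD) (sum_partition_setU1 _ (urn k)) ?setD11 // cardsU1 setD11.
have := IH _ cDx k.+1; rewrite cDx add1n addSnnS => <-.
by apply: eq_bigr => P _.
Qed.

Lemma Bell_urn m : Bell m = urn m 0.
Proof.
rewrite -[in RHS](card_ord m) -cardsT -(sum_partition_urn _ 0) sum1_card.
by rewrite /Bell cardsE.
Qed.

(* [urn n k] modulo 8 only depends on [k] modulo 8; the row of its residues
   is periodic in [n] with period 24. *)
Definition next_row (s : seq nat) : seq nat :=
  [seq (k * nth 0 s k + nth 0 s (k.+1 %% 8)) %% 8 | k <- iota 0 8].

Lemma urn_mod8 n k : urn n k %% 8 = nth 0 (iter n next_row (nseq 8 1)) (k %% 8).
Proof.
elim: n k => [|n IH] k; first by rewrite nth_nseq ltn_mod.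
have k8 : k %% 8 < 8 by rewrite ltn_mod.
rewrite [urn _ _]/= iterS (nth_map 0) ?size_iota // nth_iota // add0n -IH.
rewrite -(addn1 (k %% 8)) modnDml addn1 -IH.
by rewrite -modnDm -modnMm -[in RHS]modnDm -[in RHS]modnMm !modn_mod.
Qed.

(** Periodicity leaves 24 rows, which are checked by computation. *)
Lemma urn_ndiv8 n : ~~ (8 %| urn n 0).
Proof.
have period : iter 24 next_row (nseq 8 1) = nseq 8 1 by vm_compute.
rewrite /dvdn urn_mod8 (divn_eq n 24) addnC iterD iterM (iter_fix _ period).
have : all (fun r => nth 0 (iter r next_row (nseq 8 1)) 0 != 0) (iota 0 24).
  by vm_compute.
by move/allP; apply; rewrite mem_iota ltn_mod.
Qed.

Lemma urn_ge5 n : 5 <= urn n.+3 0.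
Proof.
have mono m k : urn m k <= urn m k.+1.
  by elim: m k => [|m IH] k //=; apply: leq_add; [apply: leq_mul|].
elim: n => [//|n IH]; apply: leq_trans IH _.
by rewrite [leqRHS]/= mul0n add0n; apply: mono.
Qed.

(** A power of 2 not divisible by 8 is 1, 2 or 4, and [urn_ge5] excludes these. *)
Lemma Bell_neq_pow2 n m : 2 < n -> Bell n <> 2 ^ m.
Proof.
case: n => [|[|[|n]]] // _; rewrite Bell_urn => e.
have := urn_ge5 n; have := urn_ndiv8 n.+3; rewrite e.
by case: m {e} => [|[|[|m]]] //; rewrite !expnS !mulnA dvdn_mulr.
Qed.

(** * Composition of isomorphisms and the conclusion *)

Lemma sba_iso_sym (S T : sbaType) : sba_iso S T -> sba_iso T S.
Proof.
move=> [f [g fK gK] [m jn d z]]; exists g; first by exists f.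
split=> [x y|x y|x y|]; apply: (can_inj fK);
  by rewrite ?m ?jn ?d ?z !gK.
Qed.

Lemma sba_iso_trans (S T U : sbaType) : sba_iso S T -> sba_iso T U -> sba_iso S U.
Proof.
move=> [f f_bij f_hom] [g g_bij g_hom]; exists (g \o f).
  exact: bij_comp.
exact: sba_hom_comp.
Qed.

(** Non-freeness is stated for [2 <= n]: for [n = 1] the exponent is 1, and the two-element algebra
    is free on one generator. *)
Theorem corollary29 (n : nat) (F : lsbiaType) (i : 'I_n -> F)
    (hn : (1 <= n)%N) (hF : is_free_lsbia i) :
  (sba_iso (quot (Dcongr F)) (pow2 ((Bell n.+1).-1)) /\
   ((2 <= n)%N ->
    ~ exists (X : Type) (G : gbaType) (j : X -> G),
        is_free_gba j /\ sba_iso (quot (Dcongr F)) G)) /\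
  (sbia_iso (quot (min_comm_congr F)) (pow2 ((2 ^ n).-1)) /\
   (forall (G : gbaType) (j : 'I_n -> G),
      is_free_gba j -> sba_iso (pow2 ((2 ^ n).-1)) G)).
Proof.
have D_iso := D_quot_iso hF; rewrite card_proper_partitions in D_iso.
have C_iso := max_comm_quot_iso hF; rewrite card_nonzero_funs in C_iso.
split; split=> //; last first.
  by move=> G j hG; have := free_gba_iso hF hG; rewrite card_nonzero_funs.
move=> n2 [X [G [j [hG G_iso]]]].
have [m e] := free_gba_pow2 hG (sba_iso_trans (sba_iso_sym D_iso) G_iso).
case: (@Bell_neq_pow2 n.+1 m n2); rewrite -e prednK //.
(* The Bell number is positive because 0 would be divisible by 8; so adding 1 to its predecessor
   gives it back. *)
by rewrite lt0n; apply: contra (urn_ndiv8 n.+1) => /eqP; rewrite Bell_urn => ->.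
Qed.
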